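(* Let $g_0\in C^\infty((0,\infty))$ be a real-valued function such that for some $\alpha>0$ and all integers $k\ge0$, $$\lim_{x\to0}x^{k-\alpha}g_0^{(k)}(x)=\lim_{x\to\infty}x^{k+1+\alpha}g_0^{(k)}(x)=0.$$ Define functions $g_k$, $k\ge1$, by the induction $g_{k+1}(x)=-x g_k'(x)-\frac12 g_k(x)$ for $k\ge0$, and set $G_{k,j}=\langle g_k^\times,g_j^\times\rangle$ for $k,j\ge0$. Then: (1) $G_{k,j}+G_{k+1,j-1}=0$ for all $k\ge0$, $j\ge1$; in particular $G_{k,k+1}=0$ for all $k\ge0$. (2) For all $k\ge0$, $$G_{k,k}=\frac{1}{2\pi}\int_{-\infty}^\infty t^{2k}\left|\frac{\zeta(\frac12+it)}{\frac12+it}\,\widehat{g_0}\left(\tfrac12+it\right)\right|^2dt.$$ (3) The Gram matrix $G=(G_{k,j})_{k,j\ge1}$ is determined by its diagonal entries: $G_{k,j}=0$ if $k+j$ is odd, and $G_{k,j}=(-1)^{(k-j)/2}\,G_{\frac{k+j}{2},\frac{k+j}{2}}$ if $k+j$ is even. Consequently, renumbering rows and columns of $G$ so that the odd indices come first and then the even ones, $G$ becomes the block diagonal matrix with diagonal blocks $\widetilde G_1=(G_{2a-1,2b-1})_{a,b\ge1}$ and $\widetilde G_2=(G_{2a,2b})_{a,b\ge1}$, and both blocks are Hankel matrices, with $$(\widetilde G_1)_{a,b}=(-1)^{a+b}G_{a+b-1,a+b-1},\qquad(\widetilde G_2)_{a,b}=(-1)^{a+b}G_{a+b,a+b}.$$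
   Context: $\{y\}$ denotes the fractional part of a real number $y$ and $\zeta$ the Riemann zeta function. For $g:(0,\infty)\to\mathbb{R}$ with $\int_0^\infty|g(x)|\,dx<\infty$ and $\int_0^\infty|g(x)|\frac{dx}{x}<\infty$ (which holds for all $g_k$ in the statement), define for $t>0$ $$g^\times(t)=\int_0^\infty\left\{\frac{x}{t}\right\}g(x)\,\frac{dx}{x},$$ which belongs to $L^2(0,\infty)$, and write $g_k^\times=(g_k)^\times$. The scalar product is that of $L^2(0,\infty)$: $\langle f,g\rangle=\int_0^\infty f(t)g(t)\,dt$ for real functions $f,g$. The Mellin transform is $\widehat{g}(s)=\int_0^\infty g(x)x^{s-1}\,dx$. A Hankel matrix is a matrix whose $(a,b)$ entry depends only on $a+b$. *)

(* Defs.v *)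
From HB Require Import structures.
From mathcomp Require Import all_boot all_order all_algebra.
From mathcomp Require Import complex zify.
From mathcomp Require Import all_classical all_reals all_analysis.

Set Implicit Arguments.
Unset Strict Implicit.
Unset Printing Implicit Defensive.

Import Order.TTheory GRing.Theory Num.Theory.
Import numFieldNormedType.Exports.
Import ComplexField.Normc.

Local Open Scope classical_set_scope.
Local Open Scope ring_scope.

(* Functions on (0, +oo) are represented by total functions R -> R; their
   values outside (0, +oo) are never used. *)

Definition smooth_pos (R : realType) (g : R -> R) : Prop :=
  forall (k : nat) (x : R), 0 < x -> derivable (derive1n k g) x 1.

Definition frac (R : realType) (y : R) : R := y - (Num.floor y)%:~R.

Definition cross (R : realType) (g : R -> R) (t : R) : R :=
  \int[lebesgue_measure]_(x in `]0, +oo[) (frac (x / t) * g x / x).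

Definition scalar_pos (R : realType) (f h : R -> R) : R :=
  \int[lebesgue_measure]_(t in `]0, +oo[) (f t * h t).

Fixpoint gseq (R : realType) (g0 : R -> R) (k : nat) : R -> R :=
  if k is k'.+1 then
    fun x => - x * derive1 (gseq g0 k') x - 2^-1 * gseq g0 k' x
  else g0.

Definition gram (R : realType) (g0 : R -> R) (k j : nat) : R :=
  scalar_pos (cross (gseq g0 k)) (cross (gseq g0 j)).

(* x ^ s = exp (s ln x) for real x > 0 and complex s *)
Definition cpow (R : realType) (x : R) (s : R[i]) : R[i] :=
  Complex (expR (complex.Re s * ln x) * cos (complex.Im s * ln x))
          (expR (complex.Re s * ln x) * sin (complex.Im s * ln x)).

Definition mellin (R : realType) (g : R -> R) (s : R[i]) : R[i] :=
  Complex
    (\int[lebesgue_measure]_(x in `]0, +oo[)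
        complex.Re (Complex (g x) 0 * cpow x (s - 1)))
    (\int[lebesgue_measure]_(x in `]0, +oo[)
        complex.Im (Complex (g x) 0 * cpow x (s - 1))).

Definition analytic_at (R : realType) (f : R[i] -> R[i]) (s : R[i]) : Prop :=
  exists (a : nat -> R[i]) (r : R), 0 < r /\
    forall z : R[i], normc (z - s) < r ->
      ((\sum_(k < n) a k * (z - s) ^+ k : R[i]^o) @[n --> \oo]
         --> (f z : R[i]^o)).

(* The Riemann zeta function: the analytic continuation to C \ {1} of the
   Dirichlet series sum_n n^(-s), Re s > 1. This determines zeta at every
   point except the pole 1, where the value is left unspecified. *)
Definition is_riemann_zeta (R : realType) (zeta : R[i] -> R[i]) : Prop :=
  (forall s : R[i], s != 1 -> analytic_at zeta s) /\
  (forall s : R[i], 1 < complex.Re s ->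
     ((\sum_(1 <= n < N) cpow n%:R (- s) : R[i]^o) @[N --> \oo]
        --> (zeta s : R[i]^o))).

(* Infinite matrices are functions nat -> nat -> R of which only the entries
   with both indices >= 1 are considered. *)

Definition hankel (R : realType) (M : nat -> nat -> R) : Prop :=
  forall a b a' b' : nat,
    (0 < a)%N -> (0 < b)%N -> (0 < a')%N -> (0 < b')%N ->
    (a + b = a' + b')%N -> M a b = M a' b'.

Definition odd_block (R : realType) (M : nat -> nat -> R) (a b : nat) : R :=
  M (2 * a - 1)%N (2 * b - 1)%N.

Definition even_block (R : realType) (M : nat -> nat -> R) (a b : nat) : R :=
  M (2 * a)%N (2 * b)%N.

(* The rows and columns of a two-block matrix are indexed by nat + nat: inl a
   is the a-th index of the first block, inr b the b-th of the second. *)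
Definition pos_index (u : nat + nat) : bool :=
  match u with inl a => (0 < a)%N | inr b => (0 < b)%N end.

Definition renum (u : nat + nat) : nat :=
  match u with inl a => (2 * a - 1)%N | inr b => (2 * b)%N end.

Definition block_diag (R : realType) (M1 M2 : nat -> nat -> R)
    (u v : nat + nat) : R :=
  match u, v with
  | inl a, inl b => M1 a b
  | inr a, inr b => M2 a b
  | _, _ => 0
  end.

Lemma renum_bij (k : nat) :
  (0 < k)%N -> exists! u : nat + nat, pos_index u /\ renum u = k.
Proof.
move=> k0; have := odd_double_half k; case: (odd k) => /= kE.
  exists (inl k./2.+1); split; first by split=> //=; rewrite -{2}kE; lia.
  by case=> a [/= a0 aE]; [congr inl | exfalso]; lia.
exists (inr k./2); split; first by split=> /=; lia.
by case=> a [/= a0 aE]; [exfalso | congr inr]; lia.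
Qed.

(* Main.v *)
Require Import Defs.
From HB Require Import structures.
From mathcomp Require Import all_boot all_order all_algebra.
From mathcomp Require Import complex ring lra zify.
From mathcomp Require Import all_classical all_reals all_analysis.
From mathcomp Require Import measurable_realfun.

Set Implicit Arguments.
Unset Strict Implicit.
Unset Printing Implicit Defensive.

Import Order.TTheory GRing.Theory Num.Theory.
Import numFieldNormedType.Exports.
Import ComplexField.Normc.

Local Open Scope classical_set_scope.
Local Open Scope ring_scope.

(** Everything becomes translation invariant in the logarithmic coordinate
    x = exp y. Put h_k y = exp (y / 2) * g_k (exp y). This is an isometry from
    square-integrable functions on the half-line to those on the line, and it
    turns the recursion for g_k into h_(k+1) = - h_k' (log_gseq,
    is_derive_log_gseq). Up to the same factor exp (y / 2), the transform of g_k
    becomes the correlation phi_k y of h_k with the fixed kernel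
    K w = frac (exp w) * exp (- w / 2) (cross_expR), so that
    phi_(k+1) = - phi_k' and G k j is the integral of phi_k * phi_j
    (gram_correlation).

    The relation G k j + G (k+1) (j-1) = 0 then says that the derivative of
    phi_k * phi_(j-1), a function decaying exponentially at both ends, has
    integral zero (correlation_skew). Together with the symmetry of G, it gives
    the antidiagonal structure by pure algebra (skew_odd, skew_even_div,
    skew_shift_even).

    For the diagonal, Plancherel's identity (plancherel) expresses G k k as
    1 / (2 pi) times the integral of the squared norm of the Fourier transform of
    phi_k. That transform is the product of those of K and h_k up to complex
    conjugation; integration by parts pulls a factor of norm |t| ^ k out of the
    transform of h_k, and the transform of h_0 at t is the Mellin transform of g0
    at s = 1 / 2 + i t (correlation_plancherel, mellin_critical). It remains to
    see that the transform of K has norm |zeta s / s| (zeta_critical), that is,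
    that zeta s is - s times the integral of frac x * x ^ (- s - 1) over the
    half-line on the critical line.

    For Re s > 1, partial summation of the Dirichlet series gives
    zeta s = s / (s - 1) - s * J s, where J s is the integral of
    frac x * x ^ (- s - 1) over x > 1 (fractional_part_summation). Both sides
    are analytic on the half-plane Re s > 0 minus the pole. To pass to the
    critical line it is enough to follow the horizontal line Im s = t for each
    t != 0, so only the identity principle for real-analytic functions of one
    real variable is used (ranalytic_identity); the analyticity of J along that
    line is that of a Laplace transform (laplace_ranalytic). Finally, for
    0 < Re s < 1 the part of the integral over x < 1 equals 1 / (1 - s), which
    absorbs the polar term.

    Plancherel's identity is needed only for continuous bounded integrable
    functions. It follows from Abel summation: the integral of the squared
    transform against exp (- e |t|) equals, by Fubini's theorem, the pairing of
    the function with its Poisson integral, and e tends to 0. *)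

(** * The substitution x = exp y *)

Section density.
Context {R : realType}.
Local Notation mu := (@lebesgue_measure R).
Local Open Scope ereal_scope.
Context (w : R -> R) (w0 : forall x, (0 <= w x)%R) (mw : measurable_fun setT w).

Definition density (A : set (measurableTypeR R)) : \bar R :=
  \int[mu]_(x in A) (w x)%:E.

Let density0 : density set0 = 0.
Proof. by rewrite /density integral_set0. Qed.

Let density_ge0 A : 0 <= density A.
Proof. by apply: integral_ge0 => x _; rewrite lee_fin. Qed.

Let density_sigma_additive : semi_sigma_additive density.
Proof.
move=> /= F mF tF mUF; rewrite /density; apply: cvg_toP.
  apply: ereal_nondecreasing_is_cvgn => m n mn.
  by apply: lee_sum_nneg_natr => // k _ _; exact: density_ge0.
rewrite ge0_integral_bigcup//=.
- by apply/measurable_EFinP; apply: measurable_funS mw.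
- by move=> x _; rewrite lee_fin.
Qed.

HB.instance Definition _ := isMeasure.Build _ _ _
  density density0 density_ge0 density_sigma_additive.

Definition density_measure : {measure set (measurableTypeR R) -> \bar R} := density.

Import HBNNSimple.

(** Simple functions first; monotone convergence does the rest. *)
Let integral_density_nnsfun (h : {nnsfun measurableTypeR R >-> R}) :
  \int[density]_x (h x)%:E = \int[mu]_x ((h x)%:E * (w x)%:E).
Proof.
rewrite integralT_nnsfun sintegralE.
transitivity (\sum_(k \in range h) \int[mu]_x (k * \1_(h @^-1` [set k]) x * w x)%:E).
  apply: eq_fsbigr => r /[!inE] -[y _ <-].
  rewrite /density [X in _ * X]integral_mkcond -ge0_integralZl_EFin//.
  - apply: eq_integral => x _; rewrite patchE indicE.
    by case: ifPn; rewrite -EFinM ?mulr1 ?mulr0 ?mul0r.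
  - by move=> x _; rewrite patchE; case: ifPn => // _; rewrite lee_fin.
  - have -> : (fun x => (w x)%:E) \_ (h @^-1` [set h y]) =
       EFin \o (w \_ (h @^-1` [set h y])) by rewrite restrict_EFin.
    apply/measurable_EFinP; apply/(measurable_restrictT _ _).1 => //.
    exact/measurable_funTS.
rewrite -ge0_integral_fsum//.
- apply: eq_integral => x _; rewrite fsumEFin// -EFinM; congr (_%:E).
  by rewrite [in RHS]fimfunE/= fsbigop.mulr_fsuml.
- move=> r; apply/measurable_EFinP; apply: measurable_funM => //.
  exact: measurable_funM.
- move=> r x _; rewrite EFinM mule_ge0 ?lee_fin//.
  by have := nnfun_muleindic_ge0 h r x; rewrite -EFinM lee_fin.
Qed.

Lemma ge0_integral_density (f : R -> \bar R) :
  measurable_fun setT f -> (forall x, 0 <= f x) ->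
  \int[density_measure]_x f x = \int[mu]_x (f x * (w x)%:E).
Proof.
move=> mf f0; pose f_ := nnsfun_approx (@measurableT _ (measurableTypeR R)) mf.
transitivity (limn (fun n => \int[density]_x (f_ n x)%:E)).
  rewrite -monotone_convergence//.
  - by apply: eq_integral => x _; apply/esym/cvg_lim => //; apply: cvg_nnsfun_approx.
  - by move=> n; exact/measurable_EFinP/measurable_funTS.
  - by move=> *; rewrite lee_fin.
  - by move=> x _ m n mn; rewrite lee_fin; exact/lefP/nd_nnsfun_approx.
transitivity (limn (fun n => \int[mu]_x ((f_ n x)%:E * (w x)%:E))).
  by congr (limn _); apply/funext => n; exact: integral_density_nnsfun.
rewrite -monotone_convergence//.
- apply: eq_integral => x _; apply/cvg_lim => //.
  apply: cvgeZr => //.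
  exact: cvg_nnsfun_approx.
- move=> n; apply: emeasurable_funM; apply/measurable_EFinP => //.
- by move=> n x _; rewrite -EFinM lee_fin mulr_ge0.
- move=> x _ m n mn; rewrite -!EFinM lee_fin ler_wpM2r//.
  exact/lefP/nd_nnsfun_approx.
Qed.

End density.

Section exp_substitution.
Context {R : realType}.
Local Notation mu := (@lebesgue_measure R).

Let expR_ge0' (x : R) : 0 <= expR x. Proof. exact: expR_ge0. Qed.
Let mexp : measurable_fun setT (@expR R). Proof. exact: measurable_expR. Qed.
Local Notation expd := (density_measure expR_ge0' mexp).

Let continuous_expN : continuous (fun x : R => expR (- x)).
Proof. by move=> x; apply: continuous_comp; [exact: opp_continuous|exact: continuous_expR]. Qed.

Let density_expR_Nybnd (b : R) : density (@expR R) `]-oo, b] = (expR b)%:E.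
Proof.
rewrite /density -{1}(opprK b) ge0_integration_by_substitutionNy//; last first.
  by apply: continuous_subspaceT; exact: continuous_expR.
rewrite (@ge0_continuous_FTC2y _ _ (fun x => - expR (- x)) _ 0)//.
- by rewrite opprK -EFinB opprK add0r.
- by move=> x _; exact: expR_ge0.
- by apply: continuous_subspaceT; exact: continuous_expN.
- rewrite -oppr0; apply: cvgN; exact: cvgr_expR.
- by apply: cvg_at_right_filter; apply: cvgN; exact: continuous_expN.
- by move=> x _; rewrite derive1E derive_val /GRing.scale/=; ring.
Qed.

Let density_expR_itv (a b : R) : a < b ->
  density (@expR R) `]a, b] = (expR b - expR a)%:E.
Proof.
move=> ab; rewrite /density integral_itv_obnd_cbnd.
  rewrite (@continuous_FTC2 _ _ expR)//.
  - by apply: continuous_subspaceT => x; exact: continuous_expR.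
  - split.
    + by move=> x _; exact: derivable_expR.
    + by apply: cvg_at_right_filter; exact: continuous_expR.
    + by apply: cvg_at_left_filter; exact: continuous_expR.
  - by move=> x _; rewrite derive1E derive_val.
by apply/measurable_EFinP/measurable_funTS.
Qed.

Let mexp' : measurable_fun setT (expR : measurableTypeR R -> measurableTypeR R).
Proof. exact: mexp. Qed.

Let measurable_npos : measurable (`]-oo, 0]%classic : set (measurableTypeR R)).
Proof. exact: measurable_itv. Qed.

Let density_expR_ocitv (a b : R) : a < b ->
  mu (`]a, b] `&` `]0, +oo[) = density (@expR R) (expR @^-1` `]a, b]).
Proof.
move=> ab; have [b0|b0] := leP b 0.
  rewrite (_ : _ `&` _ = set0); last first.
    apply/seteqP; split=> x //=; rewrite !in_itv/= andbT => -[/andP[_ xb] x0].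
    by move: (lt_le_trans x0 xb); rewrite ltNge b0.
  rewrite (_ : _ @^-1` _ = set0) ?measure0//.
  apply/seteqP; split=> x //=; rewrite !in_itv/= => /andP[_ xb].
  by move: (lt_le_trans (expR_gt0 x) xb); rewrite ltNge b0.
have eb x : (expR x <= b) = (x <= ln b) by rewrite -{1}(lnK b0) ler_expR.
have [a0|a0] := leP a 0.
  rewrite (_ : _ `&` _ = `]0, b]%classic); last first.
    apply/seteqP; split=> x /=; rewrite !in_itv/= ?andbT; first by case=> /andP[_ ->] ->.
    by move=> /andP[x0 ->]; rewrite x0 (le_lt_trans a0 x0).
  rewrite (_ : _ @^-1` _ = `]-oo, ln b]%classic); last first.
    apply/seteqP; split=> x /=; rewrite !in_itv/= eb; first by case/andP.
    by move=> ->; rewrite (le_lt_trans a0 (expR_gt0 x)).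
  by rewrite density_expR_Nybnd lnK// lebesgue_measure_itv/= lte_fin b0 oppr0 addr0.
rewrite (_ : _ `&` _ = `]a, b]%classic); last first.
  apply/seteqP; split=> x /=; rewrite !in_itv/= ?andbT; first by case.
  by move=> /andP[xa ->]; rewrite xa (lt_trans a0 xa).
have ea x : (a < expR x) = (ln a < x) by rewrite -{1}(lnK a0) ltr_expR.
rewrite (_ : _ @^-1` _ = `]ln a, ln b]%classic); last first.
  by apply/seteqP; split=> x /=; rewrite !in_itv/= eb ea.
by rewrite density_expR_itv ?ltr_ln// !lnK// lebesgue_measure_itv/= lte_fin ab EFinB.
Qed.

(** Lebesgue measure on the half-line is the image under exp of the measure
    with density exp. Uniqueness of Lebesgue measure is a statement about the
    whole line, so the image is first completed by Lebesgue measure on the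
    nonpositive half-line; the two measures then agree on half-open
    intervals. *)
Let lebesgue_pos_density (A : set (measurableTypeR R)) : measurable A ->
  mu (A `&` `]0, +oo[) = density (@expR R) (expR @^-1` A).
Proof.
pose m0 :=
  measure_add (pushforward expd (expR : measurableTypeR R -> measurableTypeR R))
    (mrestr mu measurable_npos).
pose m : {measure set (measurableTypeR R) -> \bar R} := m0 mexp'.
have mE B : m B = (density (@expR R) (expR @^-1` B) + mu (B `&` `]-oo, 0%R]))%E.
  by rewrite [LHS]measure_addE.
have disj : `]0%R, +oo[ `&` `]-oo, 0%R] = set0 :> set R.
  by rewrite -setCitvl setICl.
have muE B : measurable B -> mu B = (mu (B `&` `]0%R, +oo[) + mu (B `&` `]-oo, 0%R]))%E.
  move=> mB; rewrite -measureU//.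
  - by rewrite -setIUr setUC -setCitvl setUv setIT.
  - exact: measurableI.
  - exact: measurableI.
  - by rewrite setIACA setIid disj setI0.
have mmu B : measurable B -> mu B = m B.
  apply: lebesgue_measure_unique => _ [[a b] _ <-] /=.
  have [ab|ba] := ltP a b; last by rewrite set_itv_ge ?bnd_simp -?leNgt// !measure0.
  by rewrite mE -density_expR_ocitv// -muE//; exact: measurable_itv.
move=> mA; have mA0 : measurable (A `&` `]0, +oo[) by exact: measurableI.
rewrite (mmu _ mA0) mE -setIA disj setI0 measure0 adde0; congr (density _ _).
apply/seteqP; split=> x /=; first by case.
by rewrite in_itv/= expR_gt0.
Qed.

Lemma ge0_integral_expR (f : R -> \bar R) :
  measurable_fun setT f -> (forall x, (0 <= f x)%E) ->
  (\int[mu]_(x in `]0%R, +oo[) f x = \int[mu]_y (f (expR y) * (expR y)%:E))%E.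
Proof.
move=> mf f0; pose phi := expR : measurableTypeR R -> measurableTypeR R.
rewrite -(ge0_integral_density expR_ge0' mexp); last 2 first.
  exact: measurableT_comp.
  by [].
transitivity (\int[pushforward expd phi]_(x in `]0%R, +oo[) f x)%E.
  apply: eq_measure_integral => A mA AS.
  rewrite [RHS](_ : _ = density (@expR R) (expR @^-1` A))//.
  by rewrite -lebesgue_pos_density// setIidl.
rewrite ge0_integral_pushforward//.
- rewrite (_ : _ @^-1` _ = setT)//.
  by apply/seteqP; split=> x //= _; rewrite in_itv/= expR_gt0.
- exact: measurable_funTS.
Qed.

(** The fractional part makes the integrands discontinuous, which is why the
    substitution is done on measures. Measurability is asked of the pulled-back
    function k because f is arbitrary outside the half-line. *)
Lemma Rintegral_expR (f k : R -> R) : measurable_fun setT k ->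
  (forall y, f (expR y) = k y) ->
  \int[mu]_(x in `]0, +oo[) f x = \int[mu]_y (k y * expR y).
Proof.
move=> mk fk; pose u := EFin \o k \o @ln R.
have mu_ : measurable_fun setT u.
  by apply/measurable_EFinP; apply: measurableT_comp => //; exact: measurable_ln.
transitivity (\int[mu]_(x in `]0, +oo[) (k (ln x))).
  apply: eq_Rintegral => x; rewrite inE/= in_itv/= andbT => x0.
  by rewrite -fk lnK.
rewrite /Rintegral; congr fine.
rewrite integralE [RHS]integralE; congr (_ - _)%E.
- rewrite ge0_integral_expR//; last exact: measurable_funepos.
  apply: eq_integral => y _.
  by rewrite !funeposE/= expRK -!EFin_max -EFinM maxr_pMl ?expR_ge0// mul0r.
- rewrite ge0_integral_expR//; last exact: measurable_funeneg.
  apply: eq_integral => y _.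
  by rewrite !funenegE/= expRK -!EFin_max -EFinM maxr_pMl ?expR_ge0// mul0r mulNr.
Qed.

End exp_substitution.

(** * Lebesgue integrals on the line *)

Section toolbox.
Context {R : realType}.
Local Notation mu := (@lebesgue_measure R).
Implicit Types (D : set R) (f g : R -> R).

Lemma le_integrable_EFin D f g : measurable D -> measurable_fun D f ->
  (forall x, D x -> `|f x| <= g x) -> mu.-integrable D (EFin \o g) ->
  mu.-integrable D (EFin \o f).
Proof.
move=> mD mf fg; apply: le_integrable => //; first exact/measurable_EFinP.
by move=> x Dx /=; rewrite lee_fin (le_trans (fg _ Dx))// ler_norm.
Qed.

Lemma integrable_measurable D f :
  mu.-integrable D (EFin \o f) -> measurable_fun D f.
Proof. by move=> /integrableP[/measurable_EFinP]. Qed.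

Lemma integrable_expR_norm (c : R) : 0 < c ->
  mu.-integrable setT (EFin \o (fun x => expR (- (c * `|x|)))).
Proof.
move=> c0.
have cf : continuous (fun x : R => expR (- (c * `|x|))).
  move=> x; apply: continuous_comp; last exact: continuous_expR.
  by apply: cvgN; apply: cvgMr; exact: norm_continuous.
have mf : measurable_fun setT (fun x : R => expR (- (c * `|x|))).
  exact: continuous_measurable_fun.
apply/integrableP; split; first exact/measurable_EFinP.
rewrite (eq_integral (fun x : measurableTypeR R => (expR (- (c * `|x|)))%:E)); last first.
  by move=> x _ /=; rewrite ger0_norm// expR_ge0.
rewrite ge0_symfun_integralT//; last first.
  by move=> x /=; rewrite normrN.
have -> : [set x : R | 0 <= x] = `[0, +oo[%classic.
  by apply/seteqP; split=> x /=; rewrite in_itv/= andbT.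
rewrite (eq_integral (fun x : measurableTypeR R => (expR (- (c * x)))%:E)); last first.
  by move=> x; rewrite inE/= in_itv/= andbT => x0; rewrite ger0_norm.
rewrite (@ge0_continuous_FTC2y _ _ (fun x => - c^-1 * expR (- (c * x))) 0 0).
- by rewrite -EFinB -EFinM ltry.
- by move=> x _; exact: expR_ge0.
- apply: continuous_subspaceT => x; apply: continuous_comp; last exact: continuous_expR.
  by apply: cvgN; apply: cvgMr; exact: cvg_id.
- rewrite -[X in _ --> X](mulr0 (- c^-1)); apply: cvgMr.
  apply: (@cvg_comp _ _ _ (fun x => c * x) (fun x => expR (- x)) _ (pinfty_nbhs R)).
    exact: gt0_cvgMry.
  exact: cvgr_expR.
- by move=> x _; exact: ex_derive.
- apply: cvg_at_right_filter; apply: cvgMr.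
  apply: (@continuous_comp _ _ _ (fun x => - (c * x)) expR); last exact: continuous_expR.
  by apply: cvgN; apply: cvgMr; exact: cvg_id.
- move=> x _; rewrite derive1E derive_val /GRing.scale/=.
  by field; rewrite gt_eqF.
Qed.

Lemma dominated_Rcvg D (f_ : nat -> R -> R) f g : measurable D ->
  (forall n, measurable_fun D (f_ n)) ->
  (forall x, D x -> f_ n x @[n --> \oo] --> f x) ->
  mu.-integrable D (EFin \o g) ->
  (forall n x, D x -> `|f_ n x| <= g x) ->
  \int[mu]_(x in D) f_ n x @[n --> \oo] --> \int[mu]_(x in D) f x.
Proof.
move=> mD mf_ f_f ig fg.
have mf : measurable_fun D f by exact: measurable_fun_cvg f_f.
have if_ : mu.-integrable D (EFin \o f).
  apply: le_integrable_EFin ig => // x Dx.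
  have h : `|f_ n x| @[n --> \oo] --> `|f x| by apply: cvg_norm; exact: f_f.
  rewrite -(cvg_lim _ h)//; apply: limr_le; first by apply/cvg_ex; exists `|f x|.
  by apply: nearW => n; exact: fg.
have [] := @dominated_convergence _ _ _ mu D mD (fun n => EFin \o f_ n) (EFin \o f)
  (EFin \o g).
- by move=> n; apply/measurable_EFinP; exact: mf_.
- exact/measurable_EFinP.
- by apply: aeW => x Dx; apply: cvg_EFin; [exact: nearW|exact: f_f].
- by [].
- by apply: aeW => x n Dx; rewrite lee_fin fg.
move=> _ _ h; apply: fine_cvg; rewrite fineK//.
exact: integrable_fin_num.
Qed.

Lemma Rintegral_EFin D f : measurable D -> mu.-integrable D (EFin \o f) ->
  (\int[mu]_(x in D) f x)%:E = (\int[mu]_(x in D) (f x)%:E)%E.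
Proof. by move=> mD fi; rewrite /Rintegral fineK//; exact: integrable_fin_num. Qed.

Section affine.
Context (a b : R) (a0 : 0 < a).

Let phi (x : measurableTypeR R) : measurableTypeR R := a * x + b.

Let mphi : measurable_fun setT phi.
Proof. by apply: measurable_funD => //; exact: measurable_funM. Qed.

(** Lebesgue measure is determined by its values on half-open intervals. *)
Let affineE (A : set (measurableTypeR R)) : measurable A ->
  mu A = (a%:E * mu (phi @^-1` A))%E.
Proof.
pose m0 := mscale (NngNum (ltW a0)) (pushforward mu phi).
apply: (@lebesgue_measure_unique R (m0 mphi)) => _ [[u v] _ <-] /=.
rewrite /m0 /mscale/= /pushforward.
have -> : phi @^-1` `]u, v] = `](u - b) / a, (v - b) / a]%classic.
  by apply/seteqP; split=> x /=; rewrite !in_itv/= /phi;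
    rewrite ltr_pdivrMr// ler_pdivlMr// mulrC ltrBlDr lerBrDr.
rewrite !lebesgue_measure_itv/= !lte_fin ltr_pM2r ?invr_gt0// ltrD2r.
case: ifPn => _; last by rewrite mule0.
by rewrite -!EFinB -EFinM; congr EFin; field; rewrite gt_eqF.
Qed.

Lemma ge0_integral_affine (f : R -> \bar R) : measurable_fun setT f ->
  (forall x, (0 <= f x)%E) ->
  (\int[mu]_x f x = a%:E * \int[mu]_x f (a * x + b)%R)%E.
Proof.
move=> mf f0.
pose m0 := mscale (NngNum (ltW a0)) (pushforward mu phi).
pose m : {measure set (measurableTypeR R) -> \bar R} := m0 mphi.
transitivity (\int[m]_x f x)%E.
  by apply: eq_measure_integral => A mA _; exact: affineE.
rewrite /m /m0 ge0_integral_mscale//; congr (_ * _)%E.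
by rewrite ge0_integral_pushforward.
Qed.

Lemma integrable_affine f : mu.-integrable setT (EFin \o f) ->
  mu.-integrable setT (EFin \o (fun x => f (a * x + b))).
Proof.
move=> fi; have mf := integrable_measurable fi.
have mfp : measurable_fun setT (fun x => f (a * x + b)).
  exact: (measurableT_comp mf mphi).
apply/integrableP; split; first exact/measurable_EFinP.
case/integrableP : fi => _; rewrite ge0_integral_affine//; last first.
  by apply: measurableT_comp => //; exact/measurable_EFinP.
have : (0 <= \int[mu]_x `|(EFin \o f) (a * x + b)%R|)%E by exact: integral_ge0.
rewrite /=; set I := (\int[mu]_x _)%E; case: I => [r _ _|_ +|//]; first exact: ltry.
by rewrite gt0_muley ?lte_fin.
Qed.

Lemma Rintegral_affine f : measurable_fun setT f ->
  \int[mu]_x f x = a * \int[mu]_x f (a * x + b).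
Proof.
move=> mf.
have mf' : measurable_fun setT (EFin \o f) by exact/measurable_EFinP.
rewrite /Rintegral integralE [in RHS]integralE.
rewrite ge0_integral_affine//; last exact: measurable_funepos.
rewrite (@ge0_integral_affine (fun x => (fun x => (f x)%:E)^\- x)%E)//; last first.
  exact: measurable_funeneg.
have -> : (\int[mu]_x (fun x => (f x)%:E)^\+ (a * x + b)%R =
    \int[mu]_x (fun x => (f (a * x + b)%R)%:E)^\+ x)%E.
  by apply: eq_integral => x _; rewrite !funeposE.
have -> : (\int[mu]_x (fun x => (f x)%:E)^\- (a * x + b)%R =
    \int[mu]_x (fun x => (f (a * x + b)%R)%:E)^\- x)%E.
  by apply: eq_integral => x _; rewrite !funenegE.
set P := (\int[mu]_x _)%E; set N := (\int[mu]_x _)%E.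
have P0 : (0 <= P)%E by exact: integral_ge0.
have N0 : (0 <= N)%E by exact: integral_ge0.
move: P N P0 N0 => [p| |] [n| |] //= _ _; rewrite ?gt0_muley ?lte_fin//= ?mulr0//.
by rewrite mulrBr.
Qed.

End affine.

Lemma Rintegral_shift b f : measurable_fun setT f ->
  \int[mu]_x f (x + b) = \int[mu]_x f x.
Proof.
move=> mf; rewrite [RHS](Rintegral_affine b ltr01)// mul1r.
by apply: eq_Rintegral => x _; rewrite mul1r.
Qed.

Lemma integrable_shift b f : mu.-integrable setT (EFin \o f) ->
  mu.-integrable setT (EFin \o (fun x => f (x + b))).
Proof.
move=> /(integrable_affine b ltr01).
by under [X in _.-integrable _ (EFin \o X)]eq_fun do rewrite mul1r.
Qed.

(** The product bound supplies the integrability on the plane that Fubini's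
    theorem asks for. *)
Lemma Rintegral_exchange (f : R -> R -> R) (p q : R -> R) :
  measurable_fun setT (fun z : measurableTypeR R * measurableTypeR R => f z.1 z.2) ->
  mu.-integrable setT (EFin \o p) -> mu.-integrable setT (EFin \o q) ->
  (forall x y, `|f x y| <= p x * q y) ->
  \int[mu]_x \int[mu]_y f x y = \int[mu]_y \int[mu]_x f x y.
Proof.
move=> mf ip iq fpq.
have fx x : mu.-integrable setT (EFin \o f x).
  apply: (@le_integrable_EFin _ _ (fun y => p x * q y)) => //.
    exact: (measurable_fun_pair2 x mf).
  under [X in _.-integrable _ X]eq_fun do rewrite /= EFinM.
  exact: integrableZl.
have fy y : mu.-integrable setT (EFin \o f^~ y).
  apply: (@le_integrable_EFin _ _ (fun x => p x * q y)) => //.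
    exact: (measurable_fun_pair1 y mf).
  under [X in _.-integrable _ X]eq_fun do rewrite /= EFinM.
  exact: integrableZr.
have -> : \int[mu]_x \int[mu]_y f x y = fine (\int[mu]_x \int[mu]_y (f x y)%:E)%E.
  by congr fine; apply: eq_integral => x _; rewrite Rintegral_EFin.
have -> : \int[mu]_y \int[mu]_x f x y = fine (\int[mu]_y \int[mu]_x (f x y)%:E)%E.
  by congr fine; apply: eq_integral => y _; rewrite Rintegral_EFin.
congr fine.
apply: (@Fubini _ _ (measurableTypeR R) (measurableTypeR R) R mu mu
  (fun z => (f z.1 z.2)%:E)).
apply/integrable12ltyP; first exact/measurable_EFinP.
pose Q := \int[mu]_y `|q y|.
have iq' : mu.-integrable setT (EFin \o (fun y => `|q y|)) by exact: integrable_norm.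
have ip' : mu.-integrable setT (EFin \o (fun y => `|p y|)) by exact: integrable_norm.
apply: (@le_lt_trans _ _ (\int[mu]_x (`|p x| * Q)%:E)%E); last first.
  apply: integrable_lty => //.
  under [X in _.-integrable _ X]eq_fun do rewrite EFinM.
  exact: integrableZr.
apply: ge0_le_integral => //.
- by move=> x _; exact: integral_ge0.
- apply: (measurable_fun_fubini_tonelli_F (fun z : measurableTypeR R * measurableTypeR R =>
    `|(f z.1 z.2)%:E|%E)) => //.
  by apply: measurableT_comp => //; exact/measurable_EFinP.
- apply/measurable_EFinP; apply: measurable_funM => //.
  exact: integrable_measurable ip'.
move=> x _; rewrite EFinM /Q Rintegral_EFin// -integralZl//.
apply: ge0_le_integral => //.
- by apply: measurableT_comp => //; exact: measurable_int (fx x).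
- by apply: emeasurable_funM => //; exact: measurable_int iq'.
- by move=> y _; rewrite -EFinM lee_fin (le_trans (fpq x y))// -normrM ler_norm.
Qed.

(** Dominated convergence applied to the restrictions of f to the segments. *)
Lemma Rintegral_exhaust D f (a_ b_ : nat -> R) : measurable D ->
  mu.-integrable D (EFin \o f) ->
  (forall n, `[a_ n, b_ n] `<=` D) ->
  (forall x, D x -> \forall n \near \oo, a_ n <= x <= b_ n) ->
  \int[mu]_(x in `[a_ n, b_ n]) f x @[n --> \oo] --> \int[mu]_(x in D) f x.
Proof.
move=> mD fi abD Dab.
have mf := integrable_measurable fi.
have E n : \int[mu]_(x in `[a_ n, b_ n]) f x =
    \int[mu]_(x in D) (f \_ `[a_ n, b_ n]) x.
  by rewrite -Rintegral_mkcondr setIidr.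
under eq_cvg do rewrite E.
apply: (@dominated_Rcvg D _ f (fun x => `|f x|)) => //.
- move=> n; apply: (measurable_funS measurableT) => //.
  apply/(measurable_restrictT _ _).1 => //.
  exact: measurable_funS mf.
- move=> x Dx; apply: cvg_near_cst; near=> n.
  rewrite patchE mem_set//= in_itv/=; near: n; exact: Dab.
- exact: integrable_norm.
- by move=> n x Dx; rewrite patchE; case: ifPn; rewrite ?normr0.
Unshelve. all: by end_near. Qed.

Lemma Rintegral_FTC2 (F f : R -> R) (a b : R) : a <= b ->
  continuous f -> (forall x : R, is_derive x 1 F (f x)) ->
  \int[mu]_(x in `[a, b]) f x = F b - F a.
Proof.
rewrite le_eqVlt => /predU1P[<- _ _|ab cf dF].
  by rewrite set_itv1 Rintegral_set1 subrr.
have cF : continuous F.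
  by move=> x; apply: differentiable_continuous; apply/derivable1_diffP; case: (dF x).
rewrite /Rintegral (@continuous_FTC2 _ f F)//.
- exact: continuous_subspaceT.
- split.
  + by move=> x _; case: (dF x).
  + by apply: cvg_at_right_filter; exact: cF.
  + by apply: cvg_at_left_filter; exact: cF.
- by move=> x _; rewrite derive1E (@derive_val _ _ _ _ _ _ _ (dF x)).
Qed.

Lemma Rintegral_FTC_lim D (F f : R -> R) (a_ b_ : nat -> R) (l : R) : measurable D ->
  continuous f -> (forall x : R, is_derive x 1 F (f x)) ->
  mu.-integrable D (EFin \o f) ->
  (forall n, a_ n <= b_ n) -> (forall n, `[a_ n, b_ n] `<=` D) ->
  (forall x, D x -> \forall n \near \oo, a_ n <= x <= b_ n) ->
  F (b_ n) - F (a_ n) @[n --> \oo] --> l ->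
  \int[mu]_(x in D) f x = l.
Proof.
move=> mD cf dF fi ab abD Dab Fl.
have h := Rintegral_exhaust mD fi abD Dab.
have {}h : F (b_ n) - F (a_ n) @[n --> \oo] --> \int[mu]_(x in D) f x.
  by under eq_cvg do rewrite -(Rintegral_FTC2 (ab _) cf dF).
exact: cvg_unique h Fl.
Qed.

Let cvg_decay (F : R -> R) (C c : R) (u : nat -> R) : 0 < c ->
  (forall n, n%:R <= `|u n|) -> (forall n, `|F (u n)| <= C * expR (- (c * `|u n|))) ->
  F (u n) @[n --> \oo] --> 0.
Proof.
move=> c0 nu FC; apply: norm_cvg0.
have C0 : 0 <= C.
  by have := le_trans (normr_ge0 _) (FC 0%N); rewrite pmulr_lge0// expR_gt0.
apply: (@squeeze_cvgr _ _ _ _ (cst 0) (fun n => C * expR (- (c * n%:R)))).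
- apply: nearW => n; rewrite normr_ge0/= (le_trans (FC n))//.
  by rewrite ler_wpM2l// ler_expR lerN2 ler_wpM2l// ltW.
- exact: cvg_cst.
- rewrite -[X in _ --> X](mulr0 C); apply: cvgMr.
  apply: (@cvg_comp _ _ _ (fun n : nat => c * n%:R) (fun x => expR (- x)) _ (pinfty_nbhs R)).
    apply: (@cvg_comp _ _ _ (fun n : nat => n%:R) (fun x : R => c * x) _ (pinfty_nbhs R)).
      exact: cvgr_idn.
    exact: gt0_cvgMry.
  exact: cvgr_expR.
Qed.

(** The form in which integration by parts is used: F is a product, and its
    decay makes the boundary terms vanish. *)
Lemma Rintegral_derive_eq0 (F f : R -> R) (C c : R) : 0 < c ->
  continuous f -> (forall x : R, is_derive x 1 F (f x)) ->
  mu.-integrable setT (EFin \o f) ->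
  (forall x, `|F x| <= C * expR (- (c * `|x|))) ->
  \int[mu]_x f x = 0.
Proof.
move=> c0 cf dF fi FC.
apply: (@Rintegral_FTC_lim setT F f (fun n => - n%:R) (fun n => n%:R)) => //.
- by move=> n; rewrite -subr_ge0 opprK addr_ge0.
- move=> x _; near=> n; rewrite -ler_norml; near: n; exact: nbhs_infty_ger.
- rewrite -[X in _ --> X](subr0 0); apply: cvgB.
  + by apply: (cvg_decay c0) => // n; rewrite ?normrN ger0_norm.
  + by apply: (@cvg_decay F C c (fun n => - n%:R)) => // n; rewrite ?normrN ger0_norm.
Unshelve. all: by end_near. Qed.

Lemma Rintegral_derive0y (F f : R -> R) (C c : R) : 0 < c ->
  continuous f -> (forall x : R, is_derive x 1 F (f x)) ->
  mu.-integrable `[0, +oo[ (EFin \o f) ->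
  (forall x, 0 <= x -> `|F x| <= C * expR (- (c * `|x|))) ->
  \int[mu]_(x in `[0, +oo[) f x = - F 0.
Proof.
move=> c0 cf dF fi FC.
apply: (@Rintegral_FTC_lim _ F f (fun n => 0) (fun n => n%:R)) => //.
- by move=> n x/=; rewrite !in_itv/= andbT => /andP[].
- move=> x /=; rewrite in_itv/= andbT => x0; near=> n; rewrite x0/=.
  near: n; exact: nbhs_infty_ger.
- rewrite -[X in _ --> X](add0r (- F 0)); apply: cvgB; last exact: cvg_cst.
  by apply: (cvg_decay c0) => n; [rewrite ger0_norm|exact: FC].
Unshelve. all: by end_near. Qed.

Lemma Rintegral_deriveNy0 (F f : R -> R) (C c : R) : 0 < c ->
  continuous f -> (forall x : R, is_derive x 1 F (f x)) ->
  mu.-integrable `]-oo, 0] (EFin \o f) ->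
  (forall x, x <= 0 -> `|F x| <= C * expR (- (c * `|x|))) ->
  \int[mu]_(x in `]-oo, 0]) f x = F 0.
Proof.
move=> c0 cf dF fi FC.
apply: (@Rintegral_FTC_lim _ F f (fun n => - n%:R) (fun n => 0)) => //.
- by move=> n x/=; rewrite !in_itv/= => /andP[].
- move=> x /=; rewrite in_itv/= => x0; near=> n; rewrite x0 andbT lerNl.
  near: n; exact: nbhs_infty_ger.
- rewrite -[X in _ --> X](subr0 (F 0)); apply: cvgB; first exact: cvg_cst.
  apply: (@cvg_decay F C c (fun n => - n%:R)) => // n; first by rewrite normrN ger0_norm.
  by apply: FC; rewrite oppr_le0.
Unshelve. all: by end_near. Qed.

(** Both halves are closed, to match the two lemmas above on half-lines; the
    common endpoint is a null set. *)
Lemma Rintegral_cut0 f : mu.-integrable setT (EFin \o f) ->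
  \int[mu]_x f x = \int[mu]_(x in `]-oo, 0]) f x + \int[mu]_(x in `[0, +oo[) f x.
Proof.
move=> fi; have mf := integrable_measurable fi.
rewrite -{1}(setUv `]-oo, 0]) Rintegral_setU//; last 3 first.
- by apply: measurableC.
- by rewrite setUv.
- exact/disj_setPCl.
by rewrite setCitvl Rintegral_itv_obnd_cbnd//; apply: integrableS fi.
Qed.

End toolbox.

(** * Fourier integrals and Plancherel's identity *)

Section fourier.
Context {R : realType}.
Local Notation mu := (@lebesgue_measure R).
Implicit Types (F f g : R -> R).

Lemma eq_integrable_EFin (D : set R) f g : measurable D ->
  (forall x, D x -> f x = g x) ->
  mu.-integrable D (EFin \o f) -> mu.-integrable D (EFin \o g).
Proof.
by move=> mD fg; apply: eq_integrable => // x; rewrite inE => Dx /=; rewrite fg.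
Qed.

Lemma integrable_bounded_mul F g (K : R) : mu.-integrable setT (EFin \o F) ->
  measurable_fun setT g -> (forall x, `|g x| <= K) ->
  mu.-integrable setT (EFin \o (fun x => F x * g x)).
Proof.
move=> iF mg gK; apply: (@le_integrable_EFin _ _ _ (fun x => K * `|F x|)) => //.
- by apply: measurable_funM => //; exact: integrable_measurable iF.
- by move=> x _; rewrite normrM mulrC ler_wpM2r.
- under [X in _.-integrable _ X]eq_fun do rewrite /= EFinM.
  by apply: integrableZl => //; exact: integrable_norm.
Qed.

Lemma integrable_mulC F g : mu.-integrable setT (EFin \o (fun x => F x * g x)) ->
  mu.-integrable setT (EFin \o (fun x => g x * F x)).
Proof. by under eq_fun do rewrite mulrC. Qed.

Lemma integrable_scale (c : R) F : mu.-integrable setT (EFin \o F) ->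
  mu.-integrable setT (EFin \o (fun x => c * F x)).
Proof.
move=> iF; under [X in _.-integrable _ X]eq_fun do rewrite /= EFinM.
exact: integrableZl.
Qed.

Lemma integrable_add F g : mu.-integrable setT (EFin \o F) ->
  mu.-integrable setT (EFin \o g) ->
  mu.-integrable setT (EFin \o (fun x => F x + g x)).
Proof.
move=> iF ig; under [X in _.-integrable _ X]eq_fun do rewrite /= EFinD.
exact: integrableD.
Qed.

Lemma continuous_Rintegral (f : R -> R -> R) g :
  (forall t, measurable_fun setT (f t)) -> (forall x, continuous (f^~ x)) ->
  mu.-integrable setT (EFin \o g) -> (forall t x, `|f t x| <= g x) ->
  continuous (fun t => \int[mu]_x f t x).
Proof.
move=> mf cf ig fg t.
have := @continuity_under_integral R _ (measurableTypeR R) mu f setT measurableT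
  (t - 1) (t + 1) _ _ g ig _.
apply.
- by move=> s _; apply: le_integrable_EFin ig => // x _; exact: fg.
- by apply: aeW => x _ s _; exact: cf.
- by move=> s _; apply: aeW => x _; exact: fg.
- by rewrite inE/= in_itv/= ltrBlDr ltrDl ltr01.
Qed.

(** The real and imaginary parts of the Fourier integral of F x * exp (i t x). *)
Definition cosT F (t : R) := \int[mu]_x (F x * cos (t * x)).
Definition sinT F (t : R) := \int[mu]_x (F x * sin (t * x)).

Lemma continuous_cosM (t : R) : continuous (fun x => cos (t * x)).
Proof.
move=> x; apply: (@continuous_comp _ _ _ (fun x => t * x) cos).
  by apply: cvgMr; exact: cvg_id.
exact: continuous_cos.
Qed.

Lemma continuous_sinM (t : R) : continuous (fun x => sin (t * x)).
Proof.
move=> x; apply: (@continuous_comp _ _ _ (fun x => t * x) sin).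
  by apply: cvgMr; exact: cvg_id.
exact: continuous_sin.
Qed.

Lemma measurable_cosM (t : R) : measurable_fun setT (fun x : R => cos (t * x)).
Proof. by apply: continuous_measurable_fun; exact: continuous_cosM. Qed.

Lemma measurable_sinM (t : R) : measurable_fun setT (fun x : R => sin (t * x)).
Proof. by apply: continuous_measurable_fun; exact: continuous_sinM. Qed.

Lemma integrable_cosM F t : mu.-integrable setT (EFin \o F) ->
  mu.-integrable setT (EFin \o (fun x => F x * cos (t * x))).
Proof.
move=> iF; apply: (integrable_bounded_mul iF (measurable_cosM t)) => x.
exact: cos_max.
Qed.

Lemma integrable_sinM F t : mu.-integrable setT (EFin \o F) ->
  mu.-integrable setT (EFin \o (fun x => F x * sin (t * x))).
Proof.
move=> iF; apply: (integrable_bounded_mul iF (measurable_sinM t)) => x.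
exact: sin_max.
Qed.

Lemma cosT_le F t : mu.-integrable setT (EFin \o F) ->
  `|cosT F t| <= \int[mu]_x `|F x|.
Proof.
move=> iF; apply: (le_trans (le_normr_Rintegral _ (integrable_cosM t iF))) => //.
apply: le_Rintegral => //; first exact/integrable_norm/integrable_cosM.
  exact: integrable_norm.
by move=> x _; rewrite normrM ler_piMr// cos_max.
Qed.

Lemma sinT_le F t : mu.-integrable setT (EFin \o F) ->
  `|sinT F t| <= \int[mu]_x `|F x|.
Proof.
move=> iF; apply: (le_trans (le_normr_Rintegral _ (integrable_sinM t iF))) => //.
apply: le_Rintegral => //; first exact/integrable_norm/integrable_sinM.
  exact: integrable_norm.
by move=> x _; rewrite normrM ler_piMr// sin_max.
Qed.

Lemma continuous_cosT F : mu.-integrable setT (EFin \o F) -> continuous (cosT F).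
Proof.
move=> iF; apply: (@continuous_Rintegral _ (fun x => `|F x|)).
- by move=> t; exact: integrable_measurable (integrable_cosM t iF).
- move=> x t; apply: cvgMr.
  by under eq_fun do rewrite mulrC; rewrite mulrC; exact: continuous_cosM.
- exact: integrable_norm.
- by move=> t x; rewrite normrM ler_piMr// cos_max.
Qed.

Lemma continuous_sinT F : mu.-integrable setT (EFin \o F) -> continuous (sinT F).
Proof.
move=> iF; apply: (@continuous_Rintegral _ (fun x => `|F x|)).
- by move=> t; exact: integrable_measurable (integrable_sinM t iF).
- move=> x t; apply: cvgMr.
  by under eq_fun do rewrite mulrC; rewrite mulrC; exact: continuous_sinM.
- exact: integrable_norm.
- by move=> t x; rewrite normrM ler_piMr// sin_max.
Qed.

Lemma normr_lincomb_le (p q a b : R) : `|a| <= 1 -> `|b| <= 1 ->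
  `|p * a + q * b| <= `|p| + `|q|.
Proof.
by move=> a1 b1; rewrite (le_trans (ler_normD _ _))// !normrM lerD// ler_piMr.
Qed.

Section exp_trig.
Context (y t al be : R) (y0 : 0 < y).

Let q := y ^+ 2 + t ^+ 2.
Let trig (w : R) := al * cos (t * w) + be * sin (t * w).
(* The sign s = 1 serves the negative half-line and s = -1 the positive one;
   F s is the primitive of f s when s ^ 2 = 1. *)
Let f (s w : R) := expR (s * y * w) * trig w.
Let F (s w : R) := expR (s * y * w) *
  (((al * s * y - be * t) * cos (t * w) + (al * t + be * s * y) * sin (t * w)) / q).
Let K := (`|al| + `|be|) * (y + `|t|) / q.

Let q_gt0 : 0 < q. Proof. by rewrite ltr_pwDl ?exprn_gt0// sqr_ge0. Qed.

Let trig_le w : `|trig w| <= `|al| + `|be|.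
Proof. exact: normr_lincomb_le (cos_max _) (sin_max _). Qed.

Let cf s : continuous (f s).
Proof.
move=> w; apply: cvgM.
  apply: (@continuous_comp _ _ _ (fun w => s * y * w) expR); last exact: continuous_expR.
  by apply: cvgMr; exact: cvg_id.
by apply: cvgD; apply: cvgMr; [exact: continuous_cosM|exact: continuous_sinM].
Qed.

Let dF s : s ^+ 2 = 1 -> forall w : R, is_derive w 1 (F s) (f s w).
Proof.
move=> s2 w; apply: is_derive_eq; rewrite /f /trig /GRing.scale/=.
transitivity (expR (s * y * w) * ((s ^+ 2 * y ^+ 2 + t ^+ 2) / q *
  (al * cos (t * w) + be * sin (t * w)))); first by field; rewrite gt_eqF.
by rewrite s2 mul1r divff ?mul1r// gt_eqF.
Qed.

Let F_le s w : s * w = - `|w| -> `|s| = 1 -> `|F s w| <= K * expR (- (y * `|w|)).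
Proof.
move=> sw s1; rewrite /F (_ : s * y * w = - (y * `|w|)); last by rewrite mulrAC sw mulNr mulrC.
rewrite normrM mulrC (ger0_norm (expR_ge0 _)).
rewrite ler_wpM2r ?expR_ge0// normrM normfV (gtr0_norm q_gt0) ler_wpM2r ?invr_ge0 ?(ltW q_gt0)//.
rewrite (le_trans (normr_lincomb_le _ _ (cos_max _) (sin_max _)))//.
rewrite (le_trans (lerD (ler_normB _ _) (ler_normD _ _)))// !normrM s1 !mulr1 (gtr0_norm y0).
by rewrite le_eqVlt; apply/orP; left; apply/eqP; ring.
Qed.

Let f_integrable s (D : set (measurableTypeR R)) : measurable D ->
  (forall w, D w -> s * w = - `|w|) -> mu.-integrable D (EFin \o f s).
Proof.
move=> mD sD; apply: (@le_integrable_EFin _ _ _ (fun w => (`|al| + `|be|) * expR (- (y * `|w|)))) => //.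
- by apply: measurable_funS (continuous_measurable_fun (@cf s)).
- move=> w /sD sw; rewrite /f (_ : s * y * w = - (y * `|w|)); last by rewrite mulrAC sw mulNr mulrC.
  by rewrite normrM mulrC (ger0_norm (expR_ge0 _)) ler_wpM2r ?expR_ge0.
- apply: (@integrableS _ _ _ _ setT) => //.
  exact: integrable_scale (integrable_expR_norm y0).
Qed.

Lemma Rintegral_exp_trigNy0 : \int[mu]_(w in `]-oo, 0])
    (expR (y * w) * (al * cos (t * w) + be * sin (t * w))) = (al * y - be * t) / (y ^+ 2 + t ^+ 2).
Proof.
have s1 (w : R) : w <= 0 -> 1 * w = - `|w| by move=> w0; rewrite ler0_norm// opprK mul1r.
rewrite (@eq_Rintegral _ _ _ mu _ (f 1)); last by move=> w _; rewrite /f mul1r.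
rewrite (@Rintegral_deriveNy0 _ (F 1) (f 1) K y y0 (@cf 1) (dF (expr1n _ _)))//.
- by rewrite /F !mulr0 expR0 sin0 cos0 !mulr1 mulr0 addr0 mul1r.
- by apply: f_integrable => // w /=; rewrite in_itv/=; exact: s1.
- by move=> w /s1 sw; apply: F_le => //; rewrite normr1.
Qed.

Lemma Rintegral_exp_trig0y : \int[mu]_(w in `[0, +oo[)
    (expR (- (y * w)) * (al * cos (t * w) + be * sin (t * w))) = (al * y + be * t) / (y ^+ 2 + t ^+ 2).
Proof.
have s1 (w : R) : 0 <= w -> -1 * w = - `|w| by move=> w0; rewrite ger0_norm// mulN1r.
have sN : (-1 : R) ^+ 2 = 1 by rewrite sqrrN expr1n.
rewrite (@eq_Rintegral _ _ _ mu _ (f (-1))); last by move=> w _; rewrite /f mulN1r mulNr.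
rewrite (@Rintegral_derive0y _ (F (-1)) (f (-1)) K y y0 (@cf (-1)) (dF sN))//.
- by rewrite /F !mulr0 expR0 sin0 cos0 !mulr1 mulr0 addr0 mul1r -mulNr; congr (_ / _); ring.
- by apply: f_integrable => // w /=; rewrite in_itv/= andbT; exact: s1.
- by move=> w /s1 sw; apply: F_le => //; rewrite normrN1.
Qed.

End exp_trig.

(** The Poisson kernel is the cosine transform of the Abel weight exp (- e |t|). *)
Lemma Rintegral_abel_cos (e u : R) : 0 < e ->
  \int[mu]_t (expR (- (e * `|t|)) * cos (t * u)) = 2 * e / (e ^+ 2 + u ^+ 2).
Proof.
move=> e0; rewrite Rintegral_cut0; last first.
  apply: (@integrable_bounded_mul _ _ 1) => //; first exact: integrable_expR_norm.
    by under eq_fun do rewrite mulrC; exact: measurable_cosM.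
  by move=> t; exact: cos_max.
rewrite (@eq_Rintegral _ _ _ mu `]-oo, 0] (fun t => expR (e * t) * (1 * cos (u * t) + 0 * sin (u * t)))); last first.
  move=> t; rewrite inE/= in_itv/= => t0.
  by rewrite ler0_norm// mulrN opprK mul1r mul0r addr0 [t * u]mulrC.
rewrite (@eq_Rintegral _ _ _ mu `[0, +oo[ (fun t => expR (- (e * t)) * (1 * cos (u * t) + 0 * sin (u * t)))); last first.
  move=> t; rewrite inE/= in_itv/= andbT => t0.
  by rewrite ger0_norm// mul1r mul0r addr0 [t * u]mulrC.
rewrite Rintegral_exp_trigNy0// Rintegral_exp_trig0y// !mul0r subr0 addr0 mul1r.
by rewrite -mulrDl mulr_natl mulr2n.
Qed.

Lemma integrable_cauchy : mu.-integrable setT (EFin \o (fun v : R => (1 + v ^+ 2)^-1)) /\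
  \int[mu]_v (1 + v ^+ 2)^-1 = pi.
Proof.
have E : (\int[mu]_v ((1 + v ^+ 2)^-1)%:E = pi%:E)%E.
  rewrite (ge0_symfun_integralT (f := fun v : R => (1 + v ^+ 2)^-1)).
  - have -> : [set x : R | 0 <= x] = `[0, +oo[%classic.
      by apply/seteqP; split=> x /=; rewrite in_itv/= andbT.
    by rewrite integral0y_oneDsqr -EFinM; congr EFin; field.
  - by move=> x; rewrite invr_ge0 addr_ge0// sqr_ge0.
  - exact: continuous_oneDsqrV.
  - by move=> x/=; rewrite sqrrN.
have mf : measurable_fun setT (fun v : R => (1 + v ^+ 2)^-1).
  by apply: continuous_measurable_fun; exact: continuous_oneDsqrV.
split; last by rewrite /Rintegral E.
apply/integrableP; split; first exact/measurable_EFinP.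
rewrite (eq_integral (fun v : measurableTypeR R => ((1 + v ^+ 2)^-1)%:E)).
  by rewrite E ltry.
by move=> v _ /=; rewrite ger0_norm// invr_ge0 addr_ge0// sqr_ge0.
Qed.

Section plancherel.
Context (F : R -> R) (M : R) (cF : continuous F) (FM : forall x, `|F x| <= M).
Context (iF : mu.-integrable setT (EFin \o F)).

Let mF : measurable_fun setT F. Proof. exact: integrable_measurable iF. Qed.
Let N := \int[mu]_x `|F x|.
Let C := cosT F.
Let S := sinT F.
Let abel (e t : R) := expR (- (e * `|t|)).

Let C_N t : `|C t| <= N. Proof. exact: cosT_le. Qed.
Let S_N t : `|S t| <= N. Proof. exact: sinT_le. Qed.
Let cC : continuous C. Proof. exact: continuous_cosT. Qed.
Let cS : continuous S. Proof. exact: continuous_sinT. Qed.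
Let mC : measurable_fun setT C. Proof. exact: continuous_measurable_fun. Qed.
Let mS : measurable_fun setT S. Proof. exact: continuous_measurable_fun. Qed.
Let mabel e : measurable_fun setT (abel e).
Proof.
apply: measurableT_comp; first exact: measurable_expR.
by apply: measurableT_comp => //; apply: measurable_funM => //; exact: measurableT_comp.
Qed.

Let sqE t : C t ^+ 2 + S t ^+ 2 =
  \int[mu]_x (F x * (C t * cos (t * x) + S t * sin (t * x))).
Proof.
rewrite (@eq_Rintegral _ _ _ mu setT (fun x : measurableTypeR R =>
  C t * (F x * cos (t * x)) + S t * (F x * sin (t * x)))); last first.
  by move=> x _; ring.
rewrite RintegralD//; last 2 first.
- exact/integrable_scale/integrable_cosM.
- exact/integrable_scale/integrable_sinM.
rewrite RintegralZl//; last exact: integrable_cosM.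
by rewrite RintegralZl// ?expr2//; exact: integrable_sinM.
Qed.

Let crossE t x : C t * cos (t * x) + S t * sin (t * x) =
  \int[mu]_y (F y * cos (t * (y - x))).
Proof.
rewrite [RHS](@eq_Rintegral _ _ _ mu setT (fun y : measurableTypeR R =>
  cos (t * x) * (F y * cos (t * y)) + sin (t * x) * (F y * sin (t * y)))); last first.
  by move=> y _; rewrite mulrBr cosB; ring.
rewrite RintegralD//; last 2 first.
- exact/integrable_scale/integrable_cosM.
- exact/integrable_scale/integrable_sinM.
rewrite RintegralZl//; last exact: integrable_cosM.
rewrite RintegralZl//; last exact: integrable_sinM.
by rewrite mulrC [X in _ + X]mulrC.
Qed.

Let mcosprod : measurable_fun setT
  (fun z : measurableTypeR R * measurableTypeR R => cos (z.1 * z.2)).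
Proof.
apply: (@measurableT_comp _ _ _ _ _ _ (@cos R)).
  by apply: continuous_measurable_fun; exact: continuous_cos.
by apply: measurable_funM; [exact: measurable_fst|exact: measurable_snd].
Qed.

Let msinprod : measurable_fun setT
  (fun z : measurableTypeR R * measurableTypeR R => sin (z.1 * z.2)).
Proof.
apply: (@measurableT_comp _ _ _ _ _ _ (@sin R)).
  by apply: continuous_measurable_fun; exact: continuous_sin.
by apply: measurable_funM; [exact: measurable_fst|exact: measurable_snd].
Qed.

Let mcosprodB (x : R) : measurable_fun setT
  (fun z : measurableTypeR R * measurableTypeR R => cos (z.1 * (z.2 - x))).
Proof.
apply: (@measurableT_comp _ _ _ _ _ _ (@cos R)).
  by apply: continuous_measurable_fun; exact: continuous_cos.
apply: measurable_funM; first exact: measurable_fst.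
by apply: measurable_funB => //; exact: measurable_snd.
Qed.

(** Two exchanges of integrals turn the Abel mean of the squared transform into
    the mean of F against its Poisson integral; the last step rescales the
    Poisson kernel to the fixed weight 2 / (1 + v ^ 2). *)
Let abel_mean e : 0 < e -> \int[mu]_t (abel e t * (C t ^+ 2 + S t ^+ 2)) =
  \int[mu]_x (F x * \int[mu]_v (F (e * v + x) * (2 / (1 + v ^+ 2)))).
Proof.
move=> e0; have iabel : mu.-integrable setT (EFin \o abel e).
  exact: integrable_expR_norm.
transitivity (\int[mu]_t \int[mu]_x
    (abel e t * (F x * (C t * cos (t * x) + S t * sin (t * x))))).
  apply: eq_Rintegral => t _; rewrite sqE RintegralZl//.
  apply: (@integrable_bounded_mul _ _ (N + N)) => //.
    apply: measurable_funD; apply: measurable_funM => //.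
      exact: measurable_cosM.
    exact: measurable_sinM.
  move=> x; rewrite (le_trans (normr_lincomb_le _ _ (cos_max _) (sin_max _)))//.
  by rewrite lerD.
rewrite (@Rintegral_exchange _ _ (fun t => (N + N) * abel e t) (fun x => `|F x|)); last 4 first.
- apply: measurable_funM; first exact: (measurableT_comp (mabel e) measurable_fst).
  apply: measurable_funM; first exact: (measurableT_comp mF measurable_snd).
  by apply: measurable_funD; apply: measurable_funM => //;
    [exact: (measurableT_comp mC measurable_fst)|exact: (measurableT_comp mS measurable_fst)].
- exact: integrable_scale.
- exact: integrable_norm.
- move=> t x; rewrite [leRHS]mulrAC [leRHS]mulrC !normrM ger0_norm ?expR_ge0//.
  rewrite ler_wpM2l ?expR_ge0// mulrC ler_wpM2r//.
  rewrite (le_trans (normr_lincomb_le _ _ (cos_max _) (sin_max _)))//.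
  by rewrite lerD.
apply: eq_Rintegral => x _.
transitivity (F x * \int[mu]_t (abel e t * (C t * cos (t * x) + S t * sin (t * x)))).
  rewrite -RintegralZl//; first by apply: eq_Rintegral => t _; ring.
  apply: (@integrable_bounded_mul _ _ (N + N)) => //.
    by apply: measurable_funD; apply: measurable_funM => //;
      under eq_fun do rewrite mulrC; [exact: measurable_cosM|exact: measurable_sinM].
  move=> t; rewrite (le_trans (normr_lincomb_le _ _ (cos_max _) (sin_max _)))//.
  by rewrite lerD.
congr (_ * _).
transitivity (\int[mu]_t \int[mu]_y (abel e t * (F y * cos (t * (y - x))))).
  apply: eq_Rintegral => t _; rewrite crossE RintegralZl//.
  apply: (@integrable_bounded_mul _ _ 1) => //; last by move=> y; exact: cos_max.
  exact: (measurable_fun_pair2 t (mcosprodB x)).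
rewrite (@Rintegral_exchange _ _ (abel e) (fun x => `|F x|)); last 4 first.
- apply: measurable_funM; first exact: (measurableT_comp (mabel e) measurable_fst).
  apply: measurable_funM; first exact: (measurableT_comp mF measurable_snd).
  exact: mcosprodB.
- by [].
- exact: integrable_norm.
- move=> t y; rewrite !normrM ger0_norm ?expR_ge0// ler_wpM2l ?expR_ge0//.
  by rewrite ler_piMr// cos_max.
transitivity (\int[mu]_y (F y * (2 * e / (e ^+ 2 + (y - x) ^+ 2)))).
  apply: eq_Rintegral => y _; rewrite -(Rintegral_abel_cos _ e0) -RintegralZl//.
    by apply: eq_Rintegral => t _; rewrite /abel; ring.
  apply: (@integrable_bounded_mul _ _ 1) => //; last by move=> t; exact: cos_max.
  exact: (measurable_fun_pair1 y (mcosprodB x)).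
rewrite (Rintegral_affine x e0); last first.
  apply: measurable_funM => //; apply: measurable_funM => //.
  apply: continuous_measurable_fun => y; apply: cvgV.
    by rewrite gt_eqF// ltr_pwDl ?exprn_gt0// sqr_ge0.
  apply: cvgD; first exact: cvg_cst.
  apply: (@cvg_comp _ _ _ (fun y => y - x) (fun z => z ^+ 2)); last exact: exprn_continuous.
  by apply: cvgB; [exact: cvg_id|exact: cvg_cst].
have D0 (v : R) : 0 < 1 + v ^+ 2 by rewrite ltr_pwDl// sqr_ge0.
have E (v : R) : F (e * v + x) * (2 * e / (e ^+ 2 + (e * v + x - x) ^+ 2)) =
    (2 / e) * ((1 + v ^+ 2)^-1 * F (e * v + x)).
  rewrite addrK exprMn; field; rewrite ?gt_eqF//=.
  by rewrite ltr_pwDl ?exprn_gt0// sqr_ge0.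
under eq_Rintegral do rewrite E.
rewrite RintegralZl//; last first.
  apply: (@integrable_bounded_mul _ _ M) => //; first exact: integrable_cauchy.1.
  by apply: measurableT_comp => //; apply: measurable_funD => //; exact: measurable_funM.
rewrite mulrA mulrCA divff ?gt_eqF// mulr1 -RintegralZl//; last first.
  apply: (@integrable_bounded_mul _ _ M) => //; first exact: integrable_cauchy.1.
  by apply: measurableT_comp => //; apply: measurable_funD => //; exact: measurable_funM.
by apply: eq_Rintegral => v _; ring.
Qed.

Let e_ (n : nat) : R := n.+1%:R^-1.

Let e_gt0 n : 0 < e_ n. Proof. by rewrite invr_gt0. Qed.

Let e_cvg : e_ n @[n --> \oo] --> 0. Proof. exact: cvg_harmonic. Qed.

Let mFaffine n x : measurable_fun setT (fun v => F (e_ n * v + x)).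
Proof. by apply: measurableT_comp => //; apply: measurable_funD => //; exact: measurable_funM. Qed.

Let ik : mu.-integrable setT (EFin \o (fun v : R => 2 / (1 + v ^+ 2))).
Proof. by apply: integrable_scale; exact: integrable_cauchy.1. Qed.

Let k_ge0 (v : R) : 0 <= 2 / (1 + v ^+ 2).
Proof. by rewrite divr_ge0// addr_ge0// sqr_ge0. Qed.

Let Ik : \int[mu]_v (2 / (1 + v ^+ 2)) = 2 * pi :> R.
Proof. by rewrite RintegralZl ?integrable_cauchy.2//; exact: integrable_cauchy.1. Qed.

Let poisson n x := \int[mu]_v (F (e_ n * v + x) * (2 / (1 + v ^+ 2))).

Let ipoisson n x : mu.-integrable setT (EFin \o (fun v => F (e_ n * v + x) * (2 / (1 + v ^+ 2)))).
Proof. by apply: integrable_mulC; apply: (@integrable_bounded_mul _ _ M). Qed.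

Let poisson_le n x : `|poisson n x| <= 2 * pi * M.
Proof.
rewrite (le_trans (le_normr_Rintegral _ (ipoisson n x)))//.
rewrite -Ik -RintegralZr//; apply: le_Rintegral => //.
- exact: integrable_norm.
- by under eq_fun do rewrite mulrC; exact: integrable_scale.
- by move=> v _; rewrite normrM mulrC (ger0_norm (k_ge0 v)) ler_wpM2l.
Qed.

Let cpoisson n : continuous (poisson n).
Proof.
apply: (@continuous_Rintegral _ (fun v => M * (2 / (1 + v ^+ 2)))).
- by move=> x; exact: integrable_measurable (ipoisson n x).
- move=> v x; apply: cvgMl; apply: (@cvg_comp _ _ _ (fun x => e_ n * v + x) F); last exact: cF.
  by apply: cvgD; [exact: cvg_cst|exact: cvg_id].
- exact: integrable_scale.
- by move=> x v; rewrite normrM (ger0_norm (k_ge0 v)) ler_wpM2r.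
Qed.

Let poisson_cvg x : poisson n x @[n --> \oo] --> 2 * pi * F x.
Proof.
have -> : 2 * pi * F x = \int[mu]_v (F x * (2 / (1 + v ^+ 2))).
  by rewrite RintegralZl// Ik mulrC.
apply: (@dominated_Rcvg _ _ _ _ (fun v => M * (2 / (1 + v ^+ 2)))) => //.
- by move=> n; exact: integrable_measurable (ipoisson n x).
- move=> v _; apply: cvgMl; apply: (@cvg_comp _ _ _ (fun n => e_ n * v + x) F); last exact: cF.
  have h : e_ n * v + x @[n --> \oo] --> x.
    rewrite -[X in _ --> X](add0r x); apply: cvgD; last exact: cvg_cst.
    by rewrite -[X in _ --> X](mul0r v); apply: cvgMl; exact: e_cvg.
  exact: h.
- exact: integrable_scale.
- by move=> n v _; rewrite normrM (ger0_norm (k_ge0 v)) ler_wpM2r.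
Qed.

Let iabel_sq n : mu.-integrable setT (EFin \o (fun t => abel (e_ n) t * (C t ^+ 2 + S t ^+ 2))).
Proof.
apply: (@integrable_bounded_mul _ _ (N ^+ 2 + N ^+ 2)).
- exact: integrable_expR_norm.
- by apply: measurable_funD; exact: measurable_funX.
- move=> t; rewrite ger0_norm ?addr_ge0 ?sqr_ge0//.
  by rewrite lerD// -real_normK ?num_real// lerXn2r ?nnegrE// (le_trans (normr_ge0 _) (C_N t)).
Qed.

(** Let the Abel parameter e_ n tend to 0 in abel_mean: the left-hand side
    increases to the integral of the squared transform, and the right-hand side
    converges because F is continuous and bounded. The left-hand side is an
    extended real because its finiteness is part of the conclusion. *)
Lemma plancherel :
  (\int[mu]_t (cosT F t ^+ 2 + sinT F t ^+ 2)%:E = (2 * pi * \int[mu]_x (F x ^+ 2))%:E)%E.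
Proof.
have abel_nd t : {homo (fun n => abel (e_ n) t) : n m / (n <= m)%N >-> n <= m}.
  move=> n m nm; rewrite ler_expR lerN2 ler_wpM2r// lef_pV2 ?posrE//.
  by rewrite ler_nat ltnS.
have abel_cvg t : abel (e_ n) t @[n --> \oo] --> (1 : R).
  rewrite -(@expR0 R); apply: continuous_cvg; first exact: continuous_expR.
  by rewrite -oppr0; apply: cvgN; rewrite -[X in _ --> X](mul0r `|t|); apply: cvgMl.
have L : (\int[mu]_t (abel (e_ n) t * (C t ^+ 2 + S t ^+ 2))%:E @[n --> \oo] -->
    \int[mu]_t (C t ^+ 2 + S t ^+ 2)%:E)%E.
  have -> : (\int[mu]_t (C t ^+ 2 + S t ^+ 2)%:E =
      \int[mu]_t (limn (fun n => (abel (e_ n) t * (C t ^+ 2 + S t ^+ 2))%:E)))%E.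
    apply: eq_integral => t _; apply/esym/cvg_lim => //; apply: cvg_EFin; first exact: nearW.
    by rewrite -[X in _ --> X]mul1r; apply: cvgMl.
  apply: cvg_monotone_convergence => //.
  - by move=> n; exact: measurable_int (iabel_sq n).
  - by move=> n t _; rewrite lee_fin mulr_ge0 ?expR_ge0// addr_ge0// sqr_ge0.
  - move=> t _ n m nm; rewrite lee_fin ler_wpM2r ?abel_nd//.
    by rewrite addr_ge0// sqr_ge0.
have P : \int[mu]_x (F x * poisson n x) @[n --> \oo] --> 2 * pi * \int[mu]_x (F x ^+ 2).
  rewrite -RintegralZl//; last first.
    by under eq_fun do rewrite expr2; apply: (@integrable_bounded_mul _ _ M).
  apply: (@dominated_Rcvg _ _ _ _ (fun x => (2 * pi * M) * `|F x|)) => //.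
  - by move=> n; apply: measurable_funM => //; exact: continuous_measurable_fun.
  - move=> x _; rewrite expr2 mulrCA; apply: cvgMr; exact: poisson_cvg.
  - by apply: integrable_scale; exact: integrable_norm.
  - by move=> n x _; rewrite normrM mulrC ler_wpM2r// poisson_le.
apply: (cvg_unique _ L); first exact: ereal_hausdorff.
have E : (fun n => (\int[mu]_t (abel (e_ n) t * (C t ^+ 2 + S t ^+ 2))%:E)%E) =
    (fun n => (\int[mu]_x (F x * poisson n x))%:E).
  by apply/funext => n; rewrite -Rintegral_EFin// abel_mean.
by rewrite E; apply: cvg_EFin => //; exact: nearW.
Qed.

End plancherel.

End fourier.

(** * The identity principle for real-analytic functions *)

Section real_analytic.
Context {R : realType}.
Implicit Types (f g : R -> R) (a b : nat -> R).

Definition ranalytic f (x : R) : Prop := exists (a : nat -> R) (r : R), 0 < r /\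
  forall h, `|h| < r -> \sum_(k < n) a k * h ^+ k @[n --> \oo] --> f (x + h).

Lemma ranalyticD f g x : ranalytic f x -> ranalytic g x ->
  ranalytic (fun y => f y + g y) x.
Proof.
move=> [a [r [r0 fa]]] [b [s [s0 gb]]].
exists (fun k => a k + b k), (Num.min r s); split; first by rewrite lt_min r0.
move=> h; rewrite lt_min => /andP[hr hs].
have -> : (fun n => \sum_(k < n) (a k + b k) * h ^+ k) =
    (fun n => \sum_(k < n) a k * h ^+ k + \sum_(k < n) b k * h ^+ k).
  by apply/funext => n; rewrite -big_split; apply: eq_bigr => k _; rewrite mulrDl.
by apply: cvgD; [exact: fa|exact: gb].
Qed.

Lemma ranalyticZ (c : R) f x : ranalytic f x -> ranalytic (fun y => c * f y) x.
Proof.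
move=> [a [r [r0 fa]]]; exists (fun k => c * a k), r; split=> // h hr.
have -> : (fun n => \sum_(k < n) (c * a k) * h ^+ k) =
    (fun n => c * \sum_(k < n) a k * h ^+ k).
  by apply/funext => n; rewrite mulr_sumr; apply: eq_bigr => k _; rewrite mulrA.
by apply: cvgMr; exact: fa.
Qed.

Lemma ranalytic_mulid f x : ranalytic f x -> ranalytic (fun y => y * f y) x.
Proof.
move=> [a [r [r0 fa]]].
exists (fun k => x * a k + (if k is k'.+1 then a k' else 0)), r; split=> // h hr.
have Sr (c : nat -> R) m : \sum_(k < m.+1) c k * h ^+ k = \sum_(k < m) c k * h ^+ k + c m * h ^+ m.
  by rewrite big_ord_recr.
have E n : \sum_(k < n.+1) (x * a k + (if k : nat is k'.+1 then a k' else 0)) * h ^+ k =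
    x * (\sum_(k < n.+1) a k * h ^+ k) + h * \sum_(k < n) a k * h ^+ k.
  elim: n => [|n IH]; first by rewrite !big_ord_recr !big_ord0/=; ring.
  by rewrite (Sr (fun k => x * a k + (if k is k'.+1 then a k' else 0))) IH (Sr a n.+1) [X in _ = _ + h * X](Sr a n) exprS; ring.
rewrite -cvg_shiftS /=; under eq_cvg do rewrite E.
rewrite mulrDl; apply: cvgD; last by apply: cvgMr; exact: fa.
by apply: cvgMr; move: (fa _ hr); rewrite -cvg_shiftS.
Qed.

Lemma ranalytic_cst (c : R) x : ranalytic (fun=> c) x.
Proof.
exists (fun k => c *+ (k == 0)%N), 1; split=> // h _.
rewrite -cvg_shiftS /=; apply: cvg_near_cst; apply: nearW => n.
rewrite big_ord_recl/= expr0 mulr1 big1 ?addr0// => i _.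
by rewrite mul0r.
Qed.

Lemma eq_ranalytic f g x : f =1 g -> ranalytic f x -> ranalytic g x.
Proof. by move=> /funext->. Qed.

(** If B bounds the terms of the series at h0, then at q * h0 the tail of the
    series beyond a 0 is at most 2 * B * q; as the whole series vanishes there,
    so is the norm of a 0, for every small q. *)
Let first_coef_eq0 a (d : R) : 0 < d ->
  (forall h, 0 < h < d -> \sum_(k < n) a k * h ^+ k @[n --> \oo] --> 0) -> a 0%N = 0.
Proof.
move=> d0 ah; pose h0 := d / 2.
have h00 : 0 < h0 by rewrite divr_gt0.
have h0d : 0 < h0 < d by rewrite h00 ltr_pdivrMr// mulr_natr mulr2n ltrDl.
have [B B0 aB] : exists2 B, 0 < B & forall k, `|a k * h0 ^+ k| <= B.
  have c : cvgn (series (fun k => a k * h0 ^+ k)).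
    by rewrite seriesEord; apply/cvg_ex; exists 0; exact: ah.
  have [B [_ Bb]] := cvg_seq_bounded (cvgP _ (cvg_series_cvg_0 c)).
  exists (`|B| + 1); first by rewrite ltr_pwDr.
  by move=> k; apply: (Bb _ _ k I); rewrite (le_lt_trans (ler_norm B))// ltrDl.
have main q : 0 < q <= 2^-1 -> `|a 0%N| <= 2 * B * q.
  move=> /andP[q0 q2]; pose h := q * h0.
  have hh : 0 < h < d.
    rewrite mulr_gt0//= (le_lt_trans _ (andP h0d).2)// ler_piMl// ?(ltW h00)//.
    by rewrite (le_trans q2)// invf_le1// ler1n.
  have := ah _ hh; rewrite -cvg_shiftS => ch.
  have ub n : `|a 0%N - \sum_(k < n.+1) a k * h ^+ k| <= 2 * B * q.
    rewrite big_ord_recl/= expr0 mulr1 opprD addrA subrr add0r normrN.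
    rewrite (le_trans (ler_norm_sum _ _ _))//.
    apply: (@le_trans _ _ (B * q * \sum_(k < n) 2^-1 ^+ k)).
      rewrite mulr_sumr; apply: ler_sum => k _.
      rewrite /h exprMn mulrCA mulrC normrM (le_trans (ler_wpM2r _ (aB _)))//.
      rewrite -mulrA ler_wpM2l ?(ltW B0)// ger0_norm ?exprn_ge0 ?(ltW q0)//.
      rewrite /bump/= add1n exprS ler_wpM2l ?(ltW q0)//.
      by rewrite lerXn2r// ?nnegrE ?(ltW q0)// invr_ge0.
    have -> : 2 * B * q = B * q * 2 by ring.
    rewrite ler_wpM2l ?mulr_ge0 ?(ltW B0) ?(ltW q0)//.
    have -> : \sum_(k < n) (2^-1 : R) ^+ k = 2 * (1 - 2^-1 ^+ n).
      elim: n => [|n IH]; first by rewrite big_ord0 expr0 subrr mulr0.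
      by rewrite big_ord_recr/= IH exprS; field.
    by rewrite ler_piMr// lerBlDr lerDl exprn_ge0// invr_ge0.
  have c2 : `|a 0%N - \sum_(k < n.+1) a k * h ^+ k| @[n --> \oo] --> `|a 0%N|.
    apply: cvg_norm; rewrite -[X in _ --> X]subr0.
    by apply: cvgB => //; exact: cvg_cst.
  rewrite -(cvg_lim _ c2)//; apply: limr_le; first by apply/cvg_ex; eexists; exact: c2.
  exact: nearW.
apply/eqP; rewrite -normr_le0 leNgt; apply/negP => a0.
pose q := Num.min 2^-1 (`|a 0%N| / (4 * B)).
have q0 : 0 < q <= 2^-1.
  by rewrite lt_min invr_gt0 ltr0n/= divr_gt0 ?mulr_gt0//= ge_min lexx.
have := main q q0; apply/negP; rewrite -ltNge.
apply: (@le_lt_trans _ _ (2 * B * (`|a 0%N| / (4 * B)))).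
  by rewrite ler_wpM2l ?mulr_ge0// ?(ltW B0)// ge_min lexx orbT.
have -> : 2 * B * (`|a 0%N| / (4 * B)) = `|a 0%N| / 2 by field; rewrite gt_eqF.
by rewrite ltr_pdivrMr// mulr_natr mulr2n ltrDl.
Qed.

(** The coefficients vanish one after the other, since the leading nonzero
    power could be divided out. *)
Lemma ranalytic_eq0_right f x (d : R) : 0 < d -> ranalytic f x ->
  (forall y, x < y < x + d -> f y = 0) ->
  exists2 r : R, 0 < r & forall h, `|h| < r -> f (x + h) = 0.
Proof.
move=> d0 [a [r [r0 fa]]] f0.
have a0 m : a m = 0.
  elim/ltn_ind: m => m IH.
  have := @first_coef_eq0 (fun k => a (m + k)%N) (Num.min d r) _ _.
  rewrite addn0; apply; first by rewrite lt_min d0.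
  move=> h; rewrite lt_min => /and3P[h0 hd hr].
  have := fa h; rewrite gtr0_norm// => /(_ hr).
  rewrite f0 ?ltrDl ?h0 ?ltrD2l// -(cvg_shiftn m) => ch.
  have hm : h ^+ m != 0 by rewrite expf_neq0// gt_eqF.
  have -> : (fun n => \sum_(k < n) a (m + k)%N * h ^+ k) =
      (fun n => (h ^+ m)^-1 * \sum_(k < n + m) a k * h ^+ k).
    apply/funext => n; rewrite addnC big_split_ord/= [X in _ * (X + _)]big1 ?add0r; last first.
      by move=> i _; rewrite IH// mul0r.
    rewrite mulr_sumr; apply: eq_bigr => i _.
    by rewrite exprD [a _ * (_ * _)]mulrCA mulKf.
  by rewrite -[X in _ --> X](mulr0 (h ^+ m)^-1); apply: cvgMr; exact: ch.
exists r => // h /fa fh; apply/esym; apply: (cvg_unique _ _ fh) => //.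
by apply: cvg_near_cst; apply: nearW => n; rewrite big1// => i _; rewrite a0 mul0r.
Qed.

(** At the supremum of the points where f is nonzero, f vanishes just to the
    right, hence in a neighbourhood: a contradiction. *)
Lemma ranalytic_identity f : (forall x, 0 < x -> ranalytic f x) ->
  (forall x, 1 < x -> f x = 0) -> forall x, 0 < x -> f x = 0.
Proof.
move=> fan f1 x x0; apply/eqP/negPn/negP => fx.
pose A := [set y | 0 < y /\ f y != 0].
have A1 : ubound A 1.
  by move=> y [_ fy]; rewrite leNgt; apply/negP => /f1; apply/eqP.
have supA : has_sup A by split; [exists x|exists 1].
pose c := sup A.
have c0 : 0 < c by rewrite (lt_le_trans x0)//; apply: ub_le_sup => //; exists 1.
have fc y : c < y -> f y = 0.
  move=> cy; apply/eqP/negPn/negP => fy.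
  have : y <= c by apply: ub_le_sup; [exists 1|split=> //; exact: lt_trans cy].
  by rewrite leNgt cy.
have [r r0 fr] : exists2 r : R, 0 < r & forall h, `|h| < r -> f (c + h) = 0.
  apply: (@ranalytic_eq0_right _ _ 1) => //; first exact: fan.
  by move=> y /andP[cy _]; exact: fc.
have [y [y0 fy] yc] := sup_adherent r0 supA.
have yc' : y <= c by apply: ub_le_sup; [exists 1|].
move: fy; rewrite -(subrK c y) addrC fr ?eqxx// ler0_norm ?subr_le0//.
by rewrite opprB ltrBlDr addrC -ltrBlDr.
Qed.

End real_analytic.

(** * Laplace transforms and the fractional part *)

Section laplace.
Context {R : realType}.
Local Notation mu := (@lebesgue_measure R).
Local Notation D := (`[(0:R), +oo[%classic : set (measurableTypeR R)).

Let mD : measurable D. Proof. exact: measurable_itv. Qed.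

Lemma integrable_expR0y (c : R) : 0 < c ->
  mu.-integrable `[0, +oo[ (EFin \o (fun w => expR (- (c * w)))).
Proof.
move=> c0; apply: (@eq_integrable_EFin _ _ (fun x : R => expR (- (c * `|x|)))) => //.
  by move=> w /=; rewrite in_itv/= andbT => w0; rewrite ger0_norm.
by apply: integrableS (integrable_expR_norm c0).
Qed.

Lemma measurable_expRM (c : R) : measurable_fun setT (fun w : R => expR (- (c * w))).
Proof.
apply: measurableT_comp; first exact: measurable_expR.
by apply: measurableT_comp => //; exact: measurable_funM.
Qed.

Lemma series_exp_coeff_le (y : R) n : 0 <= y -> \sum_(k < n) y ^+ k / k`!%:R <= expR y.
Proof.
move=> y0; have <- : series (exp_coeff y) n = \sum_(k < n) y ^+ k / k`!%:R.
  by rewrite seriesEord.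
apply: nondecreasing_cvgn_le; last exact: is_cvg_series_exp_coeff.
by apply/nondecreasing_seqP => k; rewrite seriesSr lerDl exp_coeff_ge0.
Qed.

Lemma exp_coeff_le (y : R) n : 0 <= y -> y ^+ n / n`!%:R <= expR y.
Proof.
move=> y0; apply: (le_trans _ (series_exp_coeff_le n.+1 y0)).
rewrite big_ord_recr/= lerDr sumr_ge0// => k _.
by rewrite divr_ge0// exprn_ge0.
Qed.

Definition laplace (p : R -> R) (x : R) :=
  \int[mu]_(w in `[0, +oo[) (p w * expR (- (x * w))).

Context (p : R -> R) (mp : measurable_fun setT p) (p1 : forall w, `|p w| <= 1).

Lemma integrable_laplace_mul (q : R -> R) (x K : R) : 0 < x -> measurable_fun setT q ->
  (forall w, 0 <= w -> `|q w| <= K * expR (x / 2 * w)) ->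
  mu.-integrable `[0, +oo[ (EFin \o (fun w => p w * expR (- (x * w)) * q w)).
Proof.
move=> x0 mq qK; apply: (@le_integrable_EFin _ _ _ (fun w => K * expR (- (x / 2 * w)))) => //.
- apply/measurable_funTS; apply: measurable_funM => //; apply: measurable_funM => //.
  exact: measurable_expRM.
- move=> w /=; rewrite in_itv/= andbT => w0.
  rewrite !normrM (ger0_norm (expR_ge0 _)).
  rewrite (@le_trans _ _ (1 * expR (- (x * w)) * (K * expR (x / 2 * w))))//.
    by rewrite ler_pM ?mulr_ge0 ?expR_ge0 ?ler_wpM2r ?expR_ge0 ?qK.
  rewrite mul1r mulrCA -expRD (_ : - (x * w) + x / 2 * w = - (x / 2 * w))//.
  by field.
- under [X in _.-integrable _ X]eq_fun do rewrite /= EFinM.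
  by apply: integrableZl => //; apply: integrable_expR0y; rewrite divr_gt0.
Qed.

Lemma integrable_laplace (x : R) : 0 < x ->
  mu.-integrable `[0, +oo[ (EFin \o (fun w => p w * expR (- (x * w)))).
Proof.
move=> x0; apply: (@eq_integrable_EFin _ _ (fun w => p w * expR (- (x * w)) * 1)) => //.
  by move=> w _; rewrite mulr1.
apply: (@integrable_laplace_mul _ _ 1) => // w w0.
by rewrite normr1 mul1r -expR0 ler_expR mulr_ge0// divr_ge0// ltW.
Qed.

(** Expand exp (- h w) under the integral sign at x + h: as long as
    |h| < x / 2 the partial sums are dominated by exp (x / 2 * w). *)
Lemma laplace_ranalytic (x : R) : 0 < x -> ranalytic (laplace p) x.
Proof.
move=> x0; have x20 : 0 < x / 2 by rewrite divr_gt0.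
pose b k (w : R) := (- w) ^+ k / k`!%:R.
have mb k : measurable_fun setT (b k).
  by apply: measurable_funM => //; apply: measurable_funX; exact: oppr_measurable.
have bK k w : 0 <= w -> `|b k w| <= (x / 2) ^- k * expR (x / 2 * w).
  move=> w0; rewrite /b normrM normrX normrN (ger0_norm w0) ger0_norm ?invr_ge0//.
  rewrite [leRHS]mulrC ler_pdivlMr ?exprn_gt0// mulrAC -exprMn [w * _]mulrC.
  by apply: exp_coeff_le; rewrite mulr_ge0// ltW.
pose a k := \int[mu]_(w in D) (p w * expR (- (x * w)) * b k w).
exists a, (x / 2); split=> // h hx.
have ib k : mu.-integrable D (EFin \o (fun w => p w * expR (- (x * w)) * b k w)).
  by apply: integrable_laplace_mul (bK k).
pose T n (w : R) := \sum_(k < n) (b k w * h ^+ k).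
have TE n w : T n w = series (exp_coeff (- (h * w))) n.
  rewrite seriesEord; apply: eq_bigr => k _.
  by rewrite /exp_coeff/= /b -mulrN exprMn mulrAC [_ * h ^+ k]mulrC.
have mT n : measurable_fun setT (T n).
  by apply: measurable_sum => k; apply: measurable_funM.
have TK n w : 0 <= w -> `|T n w| <= 1 * expR (x / 2 * w).
  move=> w0; rewrite mul1r TE seriesEord (le_trans (ler_norm_sum _ _ _))//.
  apply: (@le_trans _ _ (\sum_(k < n) (`|h| * w) ^+ k / k`!%:R)).
    apply: ler_sum => k _; rewrite /exp_coeff/= normrM normrX normrN normrM (ger0_norm w0).
    by rewrite (ger0_norm (_ : 0 <= (k`!%:R)^-1)) ?invr_ge0.
  rewrite (le_trans (series_exp_coeff_le _ _)) ?mulr_ge0//.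
  by rewrite ler_expR ler_wpM2r// ltW.
have iT n : mu.-integrable D (EFin \o (fun w => p w * expR (- (x * w)) * T n w)).
  by apply: integrable_laplace_mul (TK n).
have E n : \sum_(k < n) a k * h ^+ k = \int[mu]_(w in D) (p w * expR (- (x * w)) * T n w).
  elim: n => [|n IH].
    rewrite big_ord0 /T (@eq_Rintegral _ _ _ mu D (fun=> 0)) ?Rintegral_cst ?mul0r//.
    by move=> w _; rewrite big_ord0 mulr0.
  rewrite big_ord_recr/= IH /a mulrC -RintegralZl// -RintegralD//.
    by apply: eq_Rintegral => w _; rewrite /T big_ord_recr/=; ring.
  under [X in _.-integrable _ X]eq_fun do rewrite /= EFinM.
  by apply: integrableZl => //; exact: ib.
under eq_cvg do rewrite E.
rewrite /laplace (@eq_Rintegral _ _ _ mu D (fun w => p w * expR (- (x * w)) * expR (- (h * w)))); last first.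
  by move=> w _; rewrite -mulrA -expRD mulrDl opprD.
apply: (@dominated_Rcvg _ _ _ _ (fun w => expR (- (x / 2 * w)))) => //.
- by move=> n; exact: integrable_measurable (iT n).
- move=> w _; apply: cvgMr; under eq_cvg do rewrite TE.
  exact: is_cvg_series_exp_coeff.
- exact: integrable_expR0y.
- move=> n w /=; rewrite in_itv/= andbT => w0.
  rewrite !normrM (ger0_norm (expR_ge0 _)).
  rewrite (@le_trans _ _ (1 * expR (- (x * w)) * (1 * expR (x / 2 * w))))//.
    by rewrite ler_pM ?mulr_ge0 ?expR_ge0 ?ler_wpM2r ?expR_ge0 ?TK.
  rewrite !mul1r -expRD (_ : - (x * w) + x / 2 * w = - (x / 2 * w))//.
  by field.
Qed.

End laplace.

Section frac.
Context {R : realType}.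
Local Notation mu := (@lebesgue_measure R).

Lemma frac_ge0 (y : R) : 0 <= Defs.frac y. Proof. by rewrite subr_ge0 floor_le. Qed.

Lemma frac_le1 (y : R) : Defs.frac y <= 1.
Proof. by rewrite lerBlDl ltW// (lt_le_trans (floorD1_gt y))// intrD. Qed.

Lemma frac_le (y : R) : 0 <= y -> Defs.frac y <= y.
Proof. by move=> y0; rewrite lerBlDr lerDl ler0z floor_ge0. Qed.

Lemma fracE (n : nat) (y : R) : n%:R <= y < n.+1%:R -> Defs.frac y = y - n%:R.
Proof.
move=> yn; rewrite /Defs.frac (_ : Num.floor y = n%:Z)//.
by apply: floor_def; rewrite intrD -!pmulrn mulr1n natr1.
Qed.

Lemma measurable_frac : measurable_fun setT (@Defs.frac R).
Proof.
apply: measurable_funB => //; apply: nondecreasing_measurable => // x y xy.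
by rewrite ler_int le_floor.
Qed.

Definition fracexp (w : R) := Defs.frac (expR w).

Lemma measurable_fracexp : measurable_fun setT fracexp.
Proof. exact: (measurableT_comp measurable_frac (@measurable_expR R)). Qed.

Lemma fracexp_norm_le1 w : `|fracexp w| <= 1.
Proof. by rewrite ger0_norm ?frac_ge0// frac_le1. Qed.

Lemma fracexp_mul_le1 (a w : R) : `|a| <= 1 -> `|fracexp w * a| <= 1.
Proof. by move=> a1; rewrite normrM mulr_ile1// fracexp_norm_le1. Qed.

End frac.

(** * The zeta function on horizontal lines *)

Section zeta_line.
Context {R : realType}.

Lemma cvg_complex_parts (u : nat -> R[i]) (l : R[i]) :
  ((u n : R[i]^o) @[n --> \oo] --> (l : R[i]^o)) ->
  (complex.Re (u n) @[n --> \oo] --> complex.Re l) /\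
  (complex.Im (u n) @[n --> \oo] --> complex.Im l).
Proof.
move=> /cvgrPdist_lt ul.
have H (e : R) : 0 < e -> \forall n \near \oo, normc (l - u n) < e.
  move=> e0; have e0' : 0 < (Complex e 0 : R[i]^o) by rewrite ltcE/= eqxx.
  have := ul _ e0'; apply: filterS => n.
  by rewrite /Num.norm/= ltcR.
split; apply/cvgrPdist_lt => e e0; have := H _ e0; apply: filterS => n; apply: le_lt_trans.
- by case: (l) (u n) => [a b] [c d] /=; rewrite -sqrtr_sqr ler_sqrt ?lerDl ?addr_ge0 ?sqr_ge0.
- by case: (l) (u n) => [a b] [c d] /=; rewrite -sqrtr_sqr ler_sqrt ?lerDr ?addr_ge0 ?sqr_ge0.
Qed.

Lemma Re_sum (u : nat -> R[i]) n : complex.Re (\sum_(k < n) u k) = \sum_(k < n) complex.Re (u k).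
Proof. by elim: n => [|n IH]; rewrite ?big_ord0// !big_ord_recr/= -IH; case: (\sum_(i < n) _) (u n) => [a b] [c d]. Qed.

Lemma Im_sum (u : nat -> R[i]) n : complex.Im (\sum_(k < n) u k) = \sum_(k < n) complex.Im (u k).
Proof. by elim: n => [|n IH]; rewrite ?big_ord0// !big_ord_recr/= -IH; case: (\sum_(i < n) _) (u n) => [a b] [c d]. Qed.

Lemma complex_real_exp (h : R) k : (Complex h 0) ^+ k = Complex (h ^+ k) 0.
Proof.
elim: k => [|k IH]; first by rewrite !expr0.
rewrite !exprS IH; apply/eqP; rewrite eq_complex/=.
by rewrite !mulr0 !mul0r subr0 addr0 !eqxx.
Qed.

(** Real increments h of the variable keep the imaginary part t fixed, and the
    real and imaginary parts of the coefficients give two real series. *)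
Lemma analytic_at_horizontal (z : R[i] -> R[i]) (x t : R) :
  analytic_at z (Complex x t) ->
  ranalytic (fun y => complex.Re (z (Complex y t))) x /\
  ranalytic (fun y => complex.Im (z (Complex y t))) x.
Proof.
move=> [a [r [r0 za]]].
have H h : `|h| < r -> (complex.Re (\sum_(k < n) a k * (Complex h 0) ^+ k) @[n --> \oo] -->
    complex.Re (z (Complex (x + h) t))) /\ (complex.Im (\sum_(k < n) a k * (Complex h 0) ^+ k) @[n --> \oo] -->
    complex.Im (z (Complex (x + h) t))).
  move=> hr; apply: cvg_complex_parts.
  have -> : Complex h 0 = Complex (x + h) t - Complex x t.
    by apply/eqP; rewrite eq_complex/= subrr [x + h]addrC addrK !eqxx.
  apply: za.
  have -> : Complex (x + h) t - Complex x t = Complex h 0.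
    by apply/eqP; rewrite eq_complex/= subrr [x + h]addrC addrK !eqxx.
  by rewrite /= expr0n/= addr0 sqrtr_sqr.
have ReE h n : complex.Re (\sum_(k < n) a k * (Complex h 0) ^+ k) =
    \sum_(k < n) complex.Re (a k) * h ^+ k.
  rewrite (Re_sum (fun k => a k * (Complex h 0) ^+ k)); apply: eq_bigr => k _.
  by rewrite complex_real_exp; case: (a k) => b c /=; rewrite mulr0 subr0.
have ImE h n : complex.Im (\sum_(k < n) a k * (Complex h 0) ^+ k) =
    \sum_(k < n) complex.Im (a k) * h ^+ k.
  rewrite (Im_sum (fun k => a k * (Complex h 0) ^+ k)); apply: eq_bigr => k _.
  by rewrite complex_real_exp; case: (a k) => b c /=; rewrite mulr0 add0r.
split.
- exists (fun k => complex.Re (a k)), r; split=> // h /H[+ _].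
  by under eq_cvg do rewrite ReE.
- exists (fun k => complex.Im (a k)), r; split=> // h /H[_].
  by under eq_cvg do rewrite ImE.
Qed.

Lemma dirichlet_parts (zeta : R[i] -> R[i]) (x t : R) : is_riemann_zeta zeta -> 1 < x ->
  \sum_(k < n) (expR (- (x * ln k.+1%:R)) * cos (t * ln k.+1%:R)) @[n --> \oo]
    --> complex.Re (zeta (Complex x t)) /\
  \sum_(k < n) (expR (- (x * ln k.+1%:R)) * sin (t * ln k.+1%:R)) @[n --> \oo]
    --> - complex.Im (zeta (Complex x t)).
Proof.
move=> [_ dz] x1.
have := dz (Complex x t) x1; rewrite -cvg_shiftS => /cvg_complex_parts.
move=> [zr zi]; split.
- move: zr; under eq_cvg do rewrite big_add1/= big_mkord (Re_sum (fun k => cpow k.+1%:R (- Complex x t))).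
  under eq_cvg do under eq_bigr do rewrite /= !mulNr cosN.
  by [].
- have : - complex.Im (\sum_(1 <= k < n.+1) cpow k%:R (- Complex x t)) @[n --> \oo] -->
    - complex.Im (zeta (Complex x t)) by exact: cvgN zi.
  under eq_cvg do rewrite big_add1/= big_mkord (Im_sum (fun k => cpow k.+1%:R (- Complex x t))) -sumrN.
  under eq_cvg do under eq_bigr do rewrite /= !mulNr sinN mulrN opprK.
  by [].
Qed.

End zeta_line.

(** * Partial summation *)

Section summation.
Context {R : realType}.
Local Notation mu := (@lebesgue_measure R).
Local Notation D := (`[(0:R), +oo[%classic : set (measurableTypeR R)).

Let mD : measurable D. Proof. exact: measurable_itv. Qed.

(** Partial summation: on the segment between ln n and ln (n + 1) the fractional
    part of exp w is exp w - n, and the integrand is the derivative of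
    (exp w - n) E w, which contributes E (ln (n + 1)). The sum starts with
    E (ln 2). *)
Lemma fractional_part_summation (E E1 : R -> R) (x K : R) : 1 < x ->
  continuous E -> continuous E1 -> (forall w : R, is_derive w 1 E (- E1 w)) ->
  (forall w, `|E w| <= K * expR (- (x * w))) ->
  (forall w, `|E1 w| <= K * expR (- (x * w))) ->
  \sum_(k < n) E (ln k.+2%:R) @[n --> \oo] -->
  \int[mu]_(w in `[0, +oo[) (expR w * E w) - \int[mu]_(w in `[0, +oo[) (fracexp w * E1 w).
Proof.
move=> x1 cE cE1 dE EK E1K.
have x0 : 0 < x by rewrite (lt_trans _ x1).
have K0 : 0 <= K.
  by have := le_trans (normr_ge0 _) (EK 0); rewrite pmulr_lge0// expR_gt0.
have mE : measurable_fun setT E by exact: continuous_measurable_fun.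
have mE1 : measurable_fun setT E1 by exact: continuous_measurable_fun.
have i1 : mu.-integrable D (EFin \o (fun w => expR w * E w)).
  apply: (@le_integrable_EFin _ _ _ (fun w => K * expR (- ((x - 1) * w)))) => //.
  - by apply/measurable_funTS; apply: measurable_funM => //; exact: measurable_expR.
  - move=> w _; rewrite normrM (ger0_norm (expR_ge0 _)) mulrC.
    rewrite (le_trans (ler_wpM2r (expR_ge0 _) (EK _)))// -mulrA -expRD.
    by rewrite (_ : - (x * w) + w = - ((x - 1) * w))//; ring.
  - under [X in _.-integrable _ X]eq_fun do rewrite /= EFinM.
    by apply: integrableZl => //; apply: integrable_expR0y; rewrite subr_gt0.
have i2 : mu.-integrable D (EFin \o (fun w => fracexp w * E1 w)).
  apply: (@le_integrable_EFin _ _ _ (fun w => K * expR (- (x * w)))) => //.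
  - by apply/measurable_funTS; apply: measurable_funM => //; exact: measurable_fracexp.
  - move=> w _; rewrite normrM (le_trans _ (E1K w))// ler_piMl//.
    exact: fracexp_norm_le1.
  - under [X in _.-integrable _ X]eq_fun do rewrite /= EFinM.
    by apply: integrableZl => //; exact: integrable_expR0y.
rewrite -RintegralB//.
pose f w := expR w * E w - fracexp w * E1 w.
have fi : mu.-integrable D (EFin \o f).
  under [X in _.-integrable _ X]eq_fun do rewrite /f /= EFinB.
  exact: integrableB.
have lnD n : `[0%R, ln n.+1%:R] `<=` D.
  by move=> w /=; rewrite !in_itv/= andbT => /andP[].
have lnoo (w : R) : D w -> \forall n \near \oo, 0 <= w <= ln n.+1%:R.
  rewrite /= in_itv/= andbT => w0; near=> n.
  rewrite w0/= -ler_expR lnK ?posrE//.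
  have : expR w <= n%:R by near: n; exact: nbhs_infty_ger.
  by move=> /le_trans; apply; rewrite ler_nat.
suff Sn n : \sum_(k < n) E (ln k.+2%:R) = \int[mu]_(w in `[0, ln n.+1%:R]) f w.
  under eq_cvg do rewrite Sn.
  exact: (@Rintegral_exhaust R D f (fun=> 0) (fun n => ln n.+1%:R)).
have ln_le (k : nat) : ln k.+1%:R <= ln k.+2%:R :> R by rewrite ler_ln ?posrE// ler_nat.
have ln0 (k : nat) : 0 <= ln k.+1%:R :> R by rewrite ln_ge0// ler1n.
elim: n => [|n IH]; first by rewrite big_ord0 ln1 set_itv1 Rintegral_set1.
rewrite big_ord_recr/= IH; apply/esym/eqP; rewrite addrC -subr_eq; apply/eqP.
rewrite Rintegral_itvB ?bnd_simp//; last by apply: integrableS fi.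
pose f_ w := expR w * E w - (expR w - n.+1%:R) * E1 w.
pose F_ w := (expR w - n.+1%:R) * E w.
have dF (w : R) : is_derive w 1 F_ (f_ w).
  apply: is_derive_eq; rewrite /f_ /GRing.scale/=; ring.
have cf_ : continuous f_.
  move=> w; apply: cvgB; first by apply: cvgM; [exact: continuous_expR|exact: cE].
  apply: cvgM; last exact: cE1.
  by apply: cvgB; [exact: continuous_expR|exact: cvg_cst].
have if_ : mu.-integrable `[ln n.+1%:R, ln n.+2%:R] (EFin \o f_).
  apply: continuous_compact_integrable; first exact: segment_compact.
  exact: continuous_subspaceT.
have sub1 : `[ln n.+1%:R, ln n.+2%:R] `<=` D.
  move=> w /=; rewrite !in_itv/= andbT => /andP[+ _]; exact: le_trans.
rewrite Rintegral_itv_obnd_cbnd; last first.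
  by apply: integrableS fi => // w /=; rewrite !in_itv/= andbT => /andP[/ltW + _]; exact: le_trans.
rewrite -Rintegral_itv_bndo_bndc; last first.
  by apply: integrableS fi => // w /=; rewrite !in_itv/= andbT => /andP[+ _]; exact: le_trans.
transitivity (\int[mu]_(w in `[ln n.+1%:R, ln n.+2%:R[) f_ w).
  apply: eq_Rintegral => w; rewrite inE/= in_itv/= => /andP[nw wn].
  rewrite /f /fracexp (@fracE _ n.+1)//.
  have n1 : (n.+1%:R : R) \is Num.pos by rewrite posrE.
  have n2 : (n.+2%:R : R) \is Num.pos by rewrite posrE.
  by apply/andP; split; [rewrite -[leLHS](lnK n1) ler_expR|rewrite -[ltRHS](lnK n2) ltr_expR].
rewrite Rintegral_itv_bndo_bndc; last first.
  by apply: integrableS if_ => // w /=; rewrite !in_itv/= => /andP[-> /ltW].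
rewrite (Rintegral_FTC2 (ln_le n) cf_ dF) /F_ !lnK ?posrE//.
by rewrite subrr mul0r subr0 -natr1 addrAC subrr add0r mul1r.
Unshelve. all: by end_near. Qed.

End summation.

(** * The zeta function on the critical line *)

Section critical_line.
Context {R : realType} (zeta : R[i] -> R[i]) (hzeta : is_riemann_zeta zeta).
Local Notation mu := (@lebesgue_measure R).
Local Notation D := (`[(0:R), +oo[%classic : set (measurableTypeR R)).

Definition fracexp_cosL (t : R) := laplace (fun w => fracexp w * cos (t * w)).
Definition fracexp_sinL (t : R) := laplace (fun w => fracexp w * sin (t * w)).

Let mcos (t : R) : measurable_fun setT (fun w => fracexp w * cos (t * w)).
Proof. by apply: measurable_funM; [exact: measurable_fracexp|exact: measurable_cosM]. Qed.

Let msin (t : R) : measurable_fun setT (fun w => fracexp w * sin (t * w)).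
Proof. by apply: measurable_funM; [exact: measurable_fracexp|exact: measurable_sinM]. Qed.

Let icos (t x : R) : 0 < x ->
  mu.-integrable D (EFin \o (fun w => fracexp w * cos (t * w) * expR (- (x * w)))).
Proof.
move=> x0; apply: integrable_laplace => //.
by move=> w; apply: fracexp_mul_le1; exact: cos_max.
Qed.

Let isin (t x : R) : 0 < x ->
  mu.-integrable D (EFin \o (fun w => fracexp w * sin (t * w) * expR (- (x * w)))).
Proof.
move=> x0; apply: integrable_laplace => //.
by move=> w; apply: fracexp_mul_le1; exact: sin_max.
Qed.

Let fracexp_trigL (t x a b : R) : 0 < x ->
  \int[mu]_(w in `[0, +oo[) (fracexp w * (expR (- (x * w)) * (a * cos (t * w) + b * sin (t * w)))) =
  a * fracexp_cosL t x + b * fracexp_sinL t x.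
Proof.
move=> x0; rewrite /fracexp_cosL /fracexp_sinL /laplace.
rewrite -RintegralZl//; last exact: icos.
rewrite -RintegralZl//; last exact: isin.
rewrite -RintegralD//; last 2 first.
- under [X in _.-integrable _ X]eq_fun do rewrite /= EFinM.
  by apply: integrableZl => //; exact: icos.
- under [X in _.-integrable _ X]eq_fun do rewrite /= EFinM.
  by apply: integrableZl => //; exact: isin.
by apply: eq_Rintegral => w _; ring.
Qed.

(** Partial summation for the damped oscillation
    exp (- x w) (a cos t w + b sin t w): at w = ln n, (a, b) = (1, 0) and
    (0, -1) give the real and imaginary parts of n ^ (- s), s = x + i t. *)
Let dirichlet_trig (x t a b : R) : 1 < x ->
  \sum_(k < n) (expR (- (x * ln k.+2%:R)) *
    (a * cos (t * ln k.+2%:R) + b * sin (t * ln k.+2%:R))) @[n --> \oo] -->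
  (a * (x - 1) + b * t) / ((x - 1) ^+ 2 + t ^+ 2) -
  ((x * a - t * b) * fracexp_cosL t x + (x * b + t * a) * fracexp_sinL t x).
Proof.
move=> x1; have x0 : 0 < x by rewrite (lt_trans _ x1).
pose E (al be w : R) := expR (- (x * w)) * (al * cos (t * w) + be * sin (t * w)).
pose K (al be : R) : R := `|al| + `|be|.
have EK al be w : `|E al be w| <= K al be * expR (- (x * w)).
  rewrite /E normrM (ger0_norm (expR_ge0 _)) mulrC ler_wpM2r ?expR_ge0//.
  exact: normr_lincomb_le (cos_max _) (sin_max _).
have cE al be : continuous (E al be).
  move=> w; apply: cvgM.
    apply: (@continuous_comp _ _ _ (fun w => - (x * w)) expR); last exact: continuous_expR.
    by apply: cvgN; apply: cvgMr; exact: cvg_id.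
  by apply: cvgD; apply: cvgMr; [exact: continuous_cosM|exact: continuous_sinM].
have dE (w : R) : is_derive w 1 (E a b) (- E (x * a - t * b) (x * b + t * a) w).
  apply: is_derive_eq; rewrite /E /GRing.scale/=; ring.
have -> : (a * (x - 1) + b * t) / ((x - 1) ^+ 2 + t ^+ 2) -
  ((x * a - t * b) * fracexp_cosL t x + (x * b + t * a) * fracexp_sinL t x) =
  \int[mu]_(w in `[0, +oo[) (expR w * E a b w) -
  \int[mu]_(w in `[0, +oo[) (fracexp w * E (x * a - t * b) (x * b + t * a) w).
  rewrite fracexp_trigL//; congr (_ - _).
  rewrite -Rintegral_exp_trig0y ?subr_gt0//; apply: eq_Rintegral => w _.
  by rewrite /E [RHS]mulrA -expRD; congr (expR _ * _); ring.
apply: (fractional_part_summation (K := Num.max (K a b) (K (x * a - t * b) (x * b + t * a))) x1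
  (cE a b) (cE _ _) dE).
- by move=> w; rewrite (le_trans (EK _ _ _))// ler_wpM2r ?expR_ge0// le_max lexx.
- by move=> w; rewrite (le_trans (EK _ _ _))// ler_wpM2r ?expR_ge0// le_max lexx orbT.
Qed.

(** In complex form, zeta s = 1 + 1 / (s - 1) - s L s, where L is the Laplace
    transform of the fractional part of exp on the half-line. *)
Let zeta_right (x t : R) : 1 < x ->
  complex.Re (zeta (Complex x t)) = 1 + (x - 1) / ((x - 1) ^+ 2 + t ^+ 2) -
    (x * fracexp_cosL t x + t * fracexp_sinL t x) /\
  complex.Im (zeta (Complex x t)) = - t / ((x - 1) ^+ 2 + t ^+ 2) +
    (x * fracexp_sinL t x - t * fracexp_cosL t x).
Proof.
move=> x1; have [zr zi] := dirichlet_parts t hzeta x1; split.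
- suff h : \sum_(k < n) (expR (- (x * ln k.+1%:R)) * cos (t * ln k.+1%:R)) @[n --> \oo] -->
      1 + (x - 1) / ((x - 1) ^+ 2 + t ^+ 2) - (x * fracexp_cosL t x + t * fracexp_sinL t x).
    exact: cvg_unique zr h.
  rewrite -cvg_shiftS.
  under eq_cvg do rewrite /= big_ord_recl/= ln1 !mulr0 oppr0 expR0 cos0 mulr1.
  rewrite -addrA; apply: cvgD; first exact: cvg_cst.
  have := @dirichlet_trig x t 1 0 x1.
  rewrite !mul1r !mul0r !mulr1 !mulr0 addr0 subr0 add0r.
  by under eq_cvg do under eq_bigr do rewrite mul1r mul0r addr0.
- apply/eqP; rewrite -eqr_opp; apply/eqP.
  suff h : \sum_(k < n) (expR (- (x * ln k.+1%:R)) * sin (t * ln k.+1%:R)) @[n --> \oo] -->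
      - (- t / ((x - 1) ^+ 2 + t ^+ 2) + (x * fracexp_sinL t x - t * fracexp_cosL t x)).
    exact: cvg_unique zi h.
  rewrite -cvg_shiftS.
  under eq_cvg do rewrite /= big_ord_recl/= ln1 !mulr0 sin0 mulr0 add0r.
  have -> : - (- t / ((x - 1) ^+ 2 + t ^+ 2) + (x * fracexp_sinL t x - t * fracexp_cosL t x)) =
      t / ((x - 1) ^+ 2 + t ^+ 2) - (- t * fracexp_cosL t x + x * fracexp_sinL t x) by ring.
  have := @dirichlet_trig x t 0 1 x1.
  rewrite !mul1r !mul0r !mulr1 !mulr0 addr0 add0r sub0r.
  under eq_cvg do under eq_bigr do rewrite mul0r mul1r add0r.
  by [].
Qed.

Let ranalytic_shift f (x c : R) : ranalytic f x -> ranalytic (fun y => (y + c) * f y) x.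
Proof.
move=> fa; apply: (@eq_ranalytic _ (fun y => y * f y + c * f y)).
  by move=> y; rewrite mulrDl.
by apply: ranalyticD; [exact: ranalytic_mulid|exact: ranalyticZ].
Qed.

(** With s = x + i t and L as above, U + i V = zeta s - 1 + s L s, and the
    claim is (s - 1) (U + i V) = 1. For fixed t != 0 both sides are analytic in
    x > 0, since the horizontal line avoids the pole, and they agree for
    x > 1. *)
Let zeta_strip (x t : R) : t != 0 -> 0 < x ->
  let U := complex.Re (zeta (Complex x t)) - 1 + x * fracexp_cosL t x + t * fracexp_sinL t x in
  let V := complex.Im (zeta (Complex x t)) - x * fracexp_sinL t x + t * fracexp_cosL t x in
  (x - 1) * U - t * V = 1 /\ (x - 1) * V + t * U = 0.
Proof.
move=> t0 x0 /=.
pose U y := complex.Re (zeta (Complex y t)) - 1 + y * fracexp_cosL t y + t * fracexp_sinL t y.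
pose V y := complex.Im (zeta (Complex y t)) - y * fracexp_sinL t y + t * fracexp_cosL t y.
have cosan y : 0 < y -> ranalytic (fracexp_cosL t) y.
  apply: laplace_ranalytic; first exact: mcos.
  by move=> w; apply: fracexp_mul_le1; exact: cos_max.
have sinan y : 0 < y -> ranalytic (fracexp_sinL t) y.
  apply: laplace_ranalytic; first exact: msin.
  by move=> w; apply: fracexp_mul_le1; exact: sin_max.
have zan y : ranalytic (fun y => complex.Re (zeta (Complex y t))) y /\
    ranalytic (fun y => complex.Im (zeta (Complex y t))) y.
  apply: analytic_at_horizontal; apply: hzeta.1.
  by rewrite eq_complex/= negb_and t0 orbT.
have Uan y : 0 < y -> ranalytic U y.
  move=> y0; apply: ranalyticD; last by apply: ranalyticZ; exact: sinan.
  apply: ranalyticD; last by apply: ranalytic_mulid; exact: cosan.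
  by apply: ranalyticD; [exact: (zan y).1|exact: ranalytic_cst].
have Van y : 0 < y -> ranalytic V y.
  move=> y0; apply: ranalyticD; last by apply: ranalyticZ; exact: cosan.
  apply: ranalyticD; first exact: (zan y).2.
  apply: (@eq_ranalytic _ (fun y => -1 * (y * fracexp_sinL t y))).
    by move=> z; rewrite mulN1r.
  by apply: ranalyticZ; apply: ranalytic_mulid; exact: sinan.
have UV y : 1 < y -> U y = (y - 1) / ((y - 1) ^+ 2 + t ^+ 2) /\ V y = - t / ((y - 1) ^+ 2 + t ^+ 2).
  by move=> y1; rewrite /U /V; have [-> ->] := zeta_right t y1; split; ring.
have q0 y : 1 < y -> (y - 1) ^+ 2 + t ^+ 2 != 0.
  by move=> y1; rewrite gt_eqF// ltr_pwDl ?sqr_ge0// exprn_gt0// subr_gt0.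
split.
- apply/eqP; rewrite -subr_eq0; apply/eqP.
  apply: (@ranalytic_identity _ (fun y => (y - 1) * U y - t * V y - 1)) => //.
  + move=> y y0; apply: ranalyticD; last exact: ranalytic_cst.
    apply: ranalyticD; first by apply: ranalytic_shift; exact: Uan.
    apply: (@eq_ranalytic _ (fun y => - t * V y)); first by move=> z; rewrite mulNr.
    by apply: ranalyticZ; exact: Van.
  + by move=> y y1; have [-> ->] := UV _ y1; field; exact: q0.
- apply: (@ranalytic_identity _ (fun y => (y - 1) * V y + t * U y)) => //.
  + move=> y y0; apply: ranalyticD; first by apply: ranalytic_shift; exact: Van.
    by apply: ranalyticZ; exact: Uan.
  + by move=> y y1; have [-> ->] := UV _ y1; field; exact: q0.
Qed.

(** The image of the fractional part function under the isometry
    f |-> f (exp w) * exp (w / 2) followed by multiplication by exp (- w): the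
    Fourier integral of kernel at - t is the integral of frac x * x ^ (- s - 1)
    over the half-line, with s = 1 / 2 + i t. *)
Definition kernel (w : R) := fracexp w * expR (- (w / 2)).

(** The fractional part of exp w is at most 1 for w >= 0 and at most exp w for
    w < 0. *)
Lemma kernel_le w : `|kernel w| <= expR (- (2^-1 * `|w|)).
Proof.
rewrite /kernel normrM (ger0_norm (expR_ge0 _)) ger0_norm ?frac_ge0//.
have [w0|w0] := leP 0 w.
  by rewrite (ger0_norm w0) [w / 2]mulrC ler_piMl ?expR_ge0 ?frac_le1.
rewrite (ltr0_norm w0) (le_trans (ler_wpM2r (expR_ge0 _) (frac_le (expR_ge0 w))))//.
by rewrite -expRD ler_expR le_eqVlt; apply/orP; left; apply/eqP; field.
Qed.

Lemma measurable_kernel : measurable_fun setT kernel.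
Proof.
apply: measurable_funM; first exact: measurable_fracexp.
apply: measurableT_comp; first exact: measurable_expR.
by apply: measurableT_comp => //; exact: measurable_funM.
Qed.

Lemma integrable_kernel : mu.-integrable setT (EFin \o kernel).
Proof.
apply: (@le_integrable_EFin _ _ _ (fun w => expR (- (2^-1 * `|w|)))) => //.
- exact: measurable_kernel.
- by move=> w _; exact: kernel_le.
- by apply: integrable_expR_norm; rewrite invr_gt0.
Qed.

Let fracexp_neg (w : R) : w < 0 -> fracexp w = expR w.
Proof.
by move=> w0; rewrite /fracexp (@fracE _ 0) ?subr0// expR_ge0/= -expR0 ltr_expR.
Qed.

(** The negative half-line, where the fractional part of exp w is exp w,
    contributes the elementary term; in complex form it is 1 / (1 - s), which
    cancels the polar part of zeta. *)
Let kernel_trig (t a b : R) :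
  \int[mu]_w (kernel w * (a * cos (t * w) + b * sin (t * w))) =
  (a / 2 - b * t) / (2^-1 ^+ 2 + t ^+ 2) +
  (a * fracexp_cosL t 2^-1 + b * fracexp_sinL t 2^-1).
Proof.
have h0 : 0 < (2^-1 : R) by rewrite invr_gt0.
have ik : mu.-integrable setT (EFin \o (fun w => kernel w * (a * cos (t * w) + b * sin (t * w)))).
  apply: (@integrable_bounded_mul _ _ _ (`|a| + `|b|)) => //; first exact: integrable_kernel.
    apply: measurable_funD; apply: measurable_funM => //.
      exact: measurable_cosM.
    exact: measurable_sinM.
  by move=> w; exact: normr_lincomb_le (cos_max _) (sin_max _).
rewrite Rintegral_cut0//; congr (_ + _).
- have E (w : R) : w < 0 -> kernel w * (a * cos (t * w) + b * sin (t * w)) =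
      expR (2^-1 * w) * (a * cos (t * w) + b * sin (t * w)).
    by move=> w0; rewrite /kernel fracexp_neg// -expRD; congr (expR _ * _); field.
  rewrite -Rintegral_exp_trigNy0// -[LHS]Rintegral_itv_bndo_bndc; last by apply: integrableS ik.
  rewrite -[RHS]Rintegral_itv_bndo_bndc; last first.
    apply: (@eq_integrable_EFin _ _ (fun w => kernel w * (a * cos (t * w) + b * sin (t * w)))) => //.
    by apply: integrableS ik.
  by apply: eq_Rintegral => w; rewrite inE/= in_itv/=; exact: E.
- rewrite -fracexp_trigL//; apply: eq_Rintegral => w _.
  by rewrite /kernel [w / 2]mulrC; ring.
Qed.

(** In complex form, zeta s = - s (cosT kernel t - i sinT kernel t) at
    s = 1 / 2 + i t: the continuation of zeta to the critical strip as - s times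
    the integral of frac x * x ^ (- s - 1). *)
Lemma zeta_critical (t : R) : t != 0 ->
  complex.Re (zeta (Complex 2^-1 t)) = - (cosT kernel t / 2 + t * sinT kernel t) /\
  complex.Im (zeta (Complex 2^-1 t)) = sinT kernel t / 2 - t * cosT kernel t.
Proof.
move=> t0; have h0 : 0 < (2^-1 : R) by rewrite invr_gt0.
have -> : cosT kernel t = 2^-1 / (2^-1 ^+ 2 + t ^+ 2) + fracexp_cosL t 2^-1.
  transitivity (\int[mu]_w (kernel w * (1 * cos (t * w) + 0 * sin (t * w)))).
    by apply: eq_Rintegral => w _; rewrite mul1r mul0r addr0.
  by rewrite kernel_trig !mul1r !mul0r subr0 addr0.
have -> : sinT kernel t = - t / (2^-1 ^+ 2 + t ^+ 2) + fracexp_sinL t 2^-1.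
  transitivity (\int[mu]_w (kernel w * (0 * cos (t * w) + 1 * sin (t * w)))).
    by apply: eq_Rintegral => w _; rewrite mul1r mul0r add0r.
  by rewrite kernel_trig !mul1r !mul0r sub0r add0r.
have [] := zeta_strip t0 h0.
set zr := complex.Re _; set zi := complex.Im _.
set jc := fracexp_cosL _ _; set js := fracexp_sinL _ _.
set U := zr - 1 + _ + _; set V := zi - _ + _ => e1 e2.
have q0 : 0 < 2^-1 ^+ 2 + t ^+ 2 by rewrite ltr_pwDl ?sqr_ge0// exprn_gt0.
have UE : (2^-1 ^+ 2 + t ^+ 2) * U = - 2^-1.
  have -> : (2^-1 ^+ 2 + t ^+ 2) * U = (2^-1 - 1) * ((2^-1 - 1) * U - t * V) + t * ((2^-1 - 1) * V + t * U) by field.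
  by rewrite e1 e2; field.
have VE : (2^-1 ^+ 2 + t ^+ 2) * V = - t.
  have -> : (2^-1 ^+ 2 + t ^+ 2) * V = (2^-1 - 1) * ((2^-1 - 1) * V + t * U) - t * ((2^-1 - 1) * U - t * V) by field.
  by rewrite e1 e2; ring.
have q1 : 2^-1 ^+ 2 + t ^+ 2 != 0 by rewrite gt_eqF.
have U2 : U = - 2^-1 / (2^-1 ^+ 2 + t ^+ 2) by apply: (mulfI q1); rewrite UE mulrCA divff// mulr1.
have V2 : V = - t / (2^-1 ^+ 2 + t ^+ 2) by apply: (mulfI q1); rewrite VE mulrCA divff// mulr1.
split.
- have -> : zr = U + 1 - 2^-1 * jc - t * js by rewrite /U; ring.
  rewrite U2; field.
  by rewrite gt_eqF// ltr_pwDl// mulr_ge0// sqr_ge0.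
- have -> : zi = V + 2^-1 * js - t * jc by rewrite /V; ring.
  rewrite V2; field.
  by rewrite gt_eqF// ltr_pwDl// mulr_ge0// sqr_ge0.
Qed.

End critical_line.

(** * Correlations with the kernel *)

Section correlation.
Context {R : realType}.
Local Notation mu := (@lebesgue_measure R).

Context (h : nat -> R -> R) (b : R) (b12 : 2^-1 < b).
Context (dh : forall k (y : R), is_derive y 1 (h k) (- h k.+1 y)).
Context (C : nat -> R) (hC : forall k y, `|h k y| <= C k * expR (- (b * `|y|))).

(** The transform g |-> cross g in logarithmic coordinates. *)
Definition correlation (k : nat) (y : R) := \int[mu]_w (kernel w * h k (y + w)).
Local Notation phi := correlation.

Let b0 : 0 < b. Proof. by rewrite (lt_trans _ b12)// invr_gt0. Qed.
Let half0 : 0 < (2^-1 : R). Proof. by rewrite invr_gt0. Qed.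

Let C0 k : 0 <= C k.
Proof. by have := le_trans (normr_ge0 _) (hC k 0); rewrite pmulr_lge0// expR_gt0. Qed.

Let ch k : continuous (h k).
Proof.
move=> y; apply: differentiable_continuous; apply/derivable1_diffP.
by case: (dh k y).
Qed.

Let mh k : measurable_fun setT (h k). Proof. exact: continuous_measurable_fun. Qed.

Let h_le k y : `|h k y| <= C k.
Proof.
rewrite (le_trans (hC k y))// ler_piMr// -expR0 ler_expR oppr_le0.
by rewrite mulr_ge0// ltW.
Qed.

Let ih k : mu.-integrable setT (EFin \o h k).
Proof.
apply: (@le_integrable_EFin _ _ _ (fun y => C k * expR (- (b * `|y|)))) => //.
by apply: integrable_scale; exact: integrable_expR_norm.
Qed.

Let mhshift k y : measurable_fun setT (fun w : R => h k (y + w)).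
Proof. by apply: measurableT_comp => //; exact: measurable_funD. Qed.

Let ikh k y : mu.-integrable setT (EFin \o (fun w => kernel w * h k (y + w))).
Proof. by apply: (@integrable_bounded_mul _ _ _ (C k)) => //; exact: integrable_kernel. Qed.

Let correlation_le k : exists K, forall y, `|phi k y| <= K * expR (- (2^-1 * `|y|)).
Proof.
have b2 : 0 < b - 2^-1 by rewrite subr_gt0.
exists (C k * \int[mu]_w expR (- ((b - 2^-1) * `|w|))) => y.
have i1 : mu.-integrable setT (EFin \o (fun w => expR (- ((b - 2^-1) * `|y + w|)))).
  apply: eq_integrable_EFin (integrable_shift y (integrable_expR_norm b2)) => // w _.
  by rewrite [w + y]addrC.
rewrite (le_trans (le_normr_Rintegral _ (ikh k y)))//.
apply: (@le_trans _ _ (\int[mu]_w (C k * expR (- (2^-1 * `|y|)) * expR (- ((b - 2^-1) * `|y + w|))))).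
  apply: le_Rintegral => //; first exact: integrable_norm.
    exact: integrable_scale.
  move=> w _; rewrite normrM (le_trans (ler_pM _ _ (kernel_le w) (hC k (y + w))))//.
  rewrite mulrCA -mulrA ler_wpM2l// -!expRD ler_expR.
  have : `|y| <= `|y + w| + `|w| by rewrite -{1}(addrK w y) ler_normB.
  lra.
rewrite RintegralZl// mulrAC.
under eq_Rintegral do rewrite [y + _]addrC.
rewrite (Rintegral_shift y (f := fun w => expR (- ((b - 2^-1) * `|w|))))//.
exact: integrable_measurable (integrable_expR_norm b2).
Qed.

(** Differentiation under the integral sign: the relation h k' = - h k.+1
    passes to the correlations. *)
Lemma is_derive_correlation k (y : R) : is_derive y 1 (phi k) (- phi k.+1 y).
Proof.
pose f (y w : R) := kernel w * h k (y + w).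
have df (z w : R) : is_derive z 1 (f^~ w) (- (kernel w * h k.+1 (z + w))).
  have d2 : is_derive z 1 (fun z => h k (z + w)) (- h k.+1 (z + w)).
    have d1 := dh k (z + w).
    by apply: is_derive_eq; rewrite addr0 mulr1.
  by apply: is_derive_eq; rewrite /GRing.scale/= mulrN.
have d1f (z w : R) : partial1of2 f z w = - (kernel w * h k.+1 (z + w)).
  by rewrite partial1of2E (@derive_val _ _ _ _ _ _ _ (df z w)).
have iG : mu.-integrable setT (EFin \o (fun w => C k.+1 * `|kernel w|)).
  by apply: integrable_scale; apply: integrable_norm; exact: integrable_kernel.
have Ia : [set` `]y - 1, y + 1[] y by rewrite /= in_itv/= ltrBlDr ltrDl ltr01.
have if_ x : [set` `]y - 1, y + 1[] x -> mu.-integrable setT (EFin \o f x).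
  by move=> _; exact: ikh.
have der x w : [set` `]y - 1, y + 1[] x -> [set: measurableTypeR R] w -> derivable (f^~ w) x 1.
  by move=> _ _; case: (df x w).
have G0 w : 0 <= C k.+1 * `|kernel w| by rewrite mulr_ge0.
have ub x w : [set` `]y - 1, y + 1[] x -> [set: measurableTypeR R] w ->
    `|partial1of2 f x w| <= C k.+1 * `|kernel w|.
  by move=> _ _; rewrite d1f normrN normrM mulrC ler_wpM2r.
have D1 := @derivable_under_integral R _ _ mu f setT measurableT y _ _ Ia if_ der _ G0 iG ub.
have D2 := @differentiation_under_integral R _ _ mu f setT measurableT y _ _ Ia if_ der _ G0 iG ub.
apply: DeriveDef; first exact: D1.
rewrite -derive1E D2 /phi -mulN1r -RintegralZl//.
by apply: eq_Rintegral => w _; rewrite d1f mulN1r.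
Qed.

Let cphi k : continuous (phi k).
Proof.
move=> y; apply: differentiable_continuous; apply/derivable1_diffP.
by case: (is_derive_correlation k y).
Qed.

Let phi_bounded k : exists K, forall y, `|phi k y| <= K.
Proof.
have [K KP] := correlation_le k; exists K => y.
rewrite (le_trans (KP y))// ler_piMr// -?expR0 ?ler_expR ?oppr_le0 ?mulr_ge0//.
by have := le_trans (normr_ge0 _) (KP 0); rewrite pmulr_lge0// expR_gt0.
Qed.

Let iphi k : mu.-integrable setT (EFin \o phi k).
Proof.
have [K KP] := correlation_le k.
apply: (@le_integrable_EFin _ _ _ (fun y => K * expR (- (2^-1 * `|y|)))) => //.
  exact: continuous_measurable_fun.
by apply: integrable_scale; exact: integrable_expR_norm.
Qed.

Let iphi2 k j : mu.-integrable setT (EFin \o (fun y => phi k y * phi j y)).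
Proof.
have [K KP] := phi_bounded j.
by apply: (@integrable_bounded_mul _ _ _ K) => //; exact: continuous_measurable_fun.
Qed.

(** The sum of the two integrals is minus the integral of the derivative of
    phi k * phi j. *)
Lemma correlation_skew k j : \int[mu]_y (phi k y * phi j.+1 y) +
  \int[mu]_y (phi k.+1 y * phi j y) = 0.
Proof.
have [K KP] := correlation_le k; have [L LP] := phi_bounded j.
have L0 : 0 <= L by rewrite (le_trans _ (LP 0)).
rewrite -RintegralD//; apply/eqP; rewrite -oppr_eq0 -mulN1r -RintegralZl//; last first.
  exact: integrable_add.
apply/eqP; apply: (@Rintegral_derive_eq0 _ (fun y => phi k y * phi j y) _ (K * L) 2^-1) => //.
- move=> y; apply: cvgMr; apply: cvgD; apply: cvgM; exact: cphi.
- move=> y; have d1 := is_derive_correlation k y; have d2 := is_derive_correlation j y.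
  by apply: is_derive_eq; rewrite /GRing.scale/=; ring.
- by apply: integrable_scale; exact: integrable_add.
- by move=> y; rewrite normrM mulrAC ler_pM.
Qed.

(** Integration by parts: differentiation becomes multiplication by - i t. *)
Let cosT_rec k t : cosT (h k.+1) t = - t * sinT (h k) t.
Proof.
have H : \int[mu]_y (- 1 * (h k.+1 y * cos (t * y)) + - t * (h k y * sin (t * y))) = 0.
  apply: (@Rintegral_derive_eq0 _ (fun y => h k y * cos (t * y)) _ (C k) b) => //.
  - move=> y; apply: cvgD; apply: cvgMr; apply: cvgM; try exact: ch.
      exact: continuous_cosM.
    exact: continuous_sinM.
  - move=> y; have d1 := dh k y.
    by apply: is_derive_eq; rewrite /GRing.scale/=; ring.
  - by apply: integrable_add; apply: integrable_scale; [exact: integrable_cosM|exact: integrable_sinM].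
  - by move=> y; rewrite normrM (le_trans _ (hC k y))// ler_piMr// cos_max.
move: H; rewrite RintegralD//; last 2 first.
- by apply: integrable_scale; exact: integrable_cosM.
- by apply: integrable_scale; exact: integrable_sinM.
rewrite RintegralZl//; last exact: integrable_cosM.
rewrite RintegralZl//; last exact: integrable_sinM.
by rewrite -/(cosT _ _) -/(sinT _ _) mulN1r addrC => /eqP; rewrite subr_eq0 => /eqP.
Qed.

Let sinT_rec k t : sinT (h k.+1) t = t * cosT (h k) t.
Proof.
have H : \int[mu]_y (- 1 * (h k.+1 y * sin (t * y)) + t * (h k y * cos (t * y))) = 0.
  apply: (@Rintegral_derive_eq0 _ (fun y => h k y * sin (t * y)) _ (C k) b) => //.
  - move=> y; apply: cvgD; apply: cvgMr; apply: cvgM; try exact: ch.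
      exact: continuous_sinM.
    exact: continuous_cosM.
  - move=> y; have d1 := dh k y.
    by apply: is_derive_eq; rewrite /GRing.scale/=; ring.
  - by apply: integrable_add; apply: integrable_scale; [exact: integrable_sinM|exact: integrable_cosM].
  - by move=> y; rewrite normrM (le_trans _ (hC k y))// ler_piMr// sin_max.
move: H; rewrite RintegralD//; last 2 first.
- by apply: integrable_scale; exact: integrable_sinM.
- by apply: integrable_scale; exact: integrable_cosM.
rewrite !RintegralZl//; first last.
- exact: integrable_cosM.
- exact: integrable_sinM.
by rewrite -/(cosT _ _) -/(sinT _ _) mulN1r addrC => /eqP; rewrite subr_eq0 => /eqP.
Qed.

Let transform_sq k t : cosT (h k) t ^+ 2 + sinT (h k) t ^+ 2 =
  t ^+ (2 * k) * (cosT (h 0%N) t ^+ 2 + sinT (h 0%N) t ^+ 2).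
Proof.
elim: k => [|k IH]; first by rewrite muln0 expr0 mul1r.
rewrite cosT_rec sinT_rec mulnS exprD -mulrA -IH; ring.
Qed.

Let mkh k : measurable_fun setT
  (fun z : measurableTypeR R * measurableTypeR R => kernel z.2 * h k (z.1 + z.2)).
Proof.
apply: measurable_funM; first exact: (measurableT_comp measurable_kernel measurable_snd).
by apply: (measurableT_comp (mh k)); apply: measurable_funD;
  [exact: measurable_fst|exact: measurable_snd].
Qed.

(** Fubini's theorem and a translation. Taken at u = cos (t .) and sin (t .),
    where u (x - w) splits into products by the addition formulas, this gives
    the convolution theorem. *)
Let correlation_pairing k (u : R -> R) : measurable_fun setT u -> (forall x, `|u x| <= 1) ->
  \int[mu]_y (phi k y * u y) = \int[mu]_w (kernel w * \int[mu]_x (h k x * u (x - w))).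
Proof.
move=> mu_ u1.
transitivity (\int[mu]_y \int[mu]_w (kernel w * h k (y + w) * u y)).
  by apply: eq_Rintegral => y _; rewrite RintegralZr.
(* Half of the decay of the kernel in w is traded for decay in y. *)
have i4 : mu.-integrable setT (EFin \o (fun w => expR (- (4^-1 * `|w|)))).
  by apply: integrable_expR_norm; rewrite invr_gt0.
rewrite (@Rintegral_exchange _ _ (fun y => C k * expR (- (4^-1 * `|y|))) (fun w => expR (- (4^-1 * `|w|)))) //.
- apply: eq_Rintegral => w _.
  transitivity (kernel w * \int[mu]_y (h k (y + w) * u (y + w - w))).
    rewrite -RintegralZl//; first by apply: eq_Rintegral => y _; rewrite addrK mulrA.
    apply: (@integrable_bounded_mul _ _ _ 1) => //; first exact: integrable_shift.
    by under eq_fun do rewrite addrK.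
  congr (_ * _).
  rewrite (Rintegral_shift w (f := fun x => h k x * u (x - w)))//.
  by apply: measurable_funM => //; apply: measurableT_comp => //; exact: measurable_funB.
- apply: measurable_funM; first exact: mkh.
  exact: (measurableT_comp mu_ measurable_fst).
- exact: integrable_scale.
- move=> y w; rewrite normrM [`|kernel w * _|]normrM (le_trans (ler_piMr _ (u1 y))) ?mulr_ge0//.
  rewrite (le_trans (ler_pM _ _ (kernel_le w) (hC k (y + w))))//.
  rewrite mulrCA -mulrA ler_wpM2l// -!expRD ler_expR.
  have h1 : `|y| <= `|y + w| + `|w| by rewrite -{1}(addrK w y) ler_normB.
  have h2 : 2^-1 * `|y + w| <= b * `|y + w| by rewrite ler_wpM2r// ltW.
  have := normr_ge0 (y + w).
  lra.
Qed.

Let cosT_correlation k t : cosT (phi k) t =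
  cosT kernel t * cosT (h k) t + sinT kernel t * sinT (h k) t.
Proof.
rewrite /cosT (correlation_pairing k (measurable_cosM t)); last by move=> x; exact: cos_max.
transitivity (\int[mu]_w (cosT (h k) t * (kernel w * cos (t * w)) + sinT (h k) t * (kernel w * sin (t * w)))).
  apply: eq_Rintegral => w _.
  transitivity (kernel w * \int[mu]_x (cos (t * w) * (h k x * cos (t * x)) + sin (t * w) * (h k x * sin (t * x)))).
    by congr (_ * _); apply: eq_Rintegral => x _; rewrite mulrBr cosB; ring.
  rewrite RintegralD//; last 2 first.
  - by apply: integrable_scale; exact: integrable_cosM.
  - by apply: integrable_scale; exact: integrable_sinM.
  rewrite RintegralZl//; last exact: integrable_cosM.
  rewrite RintegralZl//; last exact: integrable_sinM.
  by rewrite -/(cosT _ _) -/(sinT _ _); ring.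
have ikc := integrable_cosM t integrable_kernel; have iks := integrable_sinM t integrable_kernel.
rewrite RintegralD//; last 2 first.
- exact: integrable_scale.
- exact: integrable_scale.
by rewrite !RintegralZl// mulrC; congr (_ + _); rewrite mulrC.
Qed.

Let sinT_correlation k t : sinT (phi k) t =
  cosT kernel t * sinT (h k) t - sinT kernel t * cosT (h k) t.
Proof.
rewrite /sinT (correlation_pairing k (measurable_sinM t)); last by move=> x; exact: sin_max.
transitivity (\int[mu]_w (sinT (h k) t * (kernel w * cos (t * w)) - cosT (h k) t * (kernel w * sin (t * w)))).
  apply: eq_Rintegral => w _.
  transitivity (kernel w * \int[mu]_x (cos (t * w) * (h k x * sin (t * x)) - sin (t * w) * (h k x * cos (t * x)))).
    by congr (_ * _); apply: eq_Rintegral => x _; rewrite mulrBr sinB; ring.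
  rewrite RintegralB//; last 2 first.
  - by apply: integrable_scale; exact: integrable_sinM.
  - by apply: integrable_scale; exact: integrable_cosM.
  rewrite RintegralZl//; last exact: integrable_sinM.
  rewrite RintegralZl//; last exact: integrable_cosM.
  by rewrite -/(cosT _ _) -/(sinT _ _); ring.
have ikc := integrable_cosM t integrable_kernel; have iks := integrable_sinM t integrable_kernel.
rewrite RintegralB//; last 2 first.
- exact: integrable_scale.
- exact: integrable_scale.
by rewrite !RintegralZl// mulrC; congr (_ - _); rewrite mulrC.
Qed.

(** The Fourier integral of phi k is that of h k times the conjugate of that of
    kernel, so its squared norm is t ^ (2 k) times the product of the squared
    norms for kernel and h 0. *)
Lemma correlation_plancherel k :
  (\int[mu]_t (t ^+ (2 * k) * ((cosT kernel t ^+ 2 + sinT kernel t ^+ 2) *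
     (cosT (h 0%N) t ^+ 2 + sinT (h 0%N) t ^+ 2)))%:E =
  (2 * pi * \int[mu]_y (phi k y * phi k y))%:E)%E.
Proof.
have [K KP] := phi_bounded k.
have := @plancherel R (phi k) K (@cphi k) KP (iphi k).
under [in RHS]eq_Rintegral do rewrite expr2.
move=> <-; apply: eq_integral => t _; congr EFin.
rewrite mulrCA -transform_sq cosT_correlation sinT_correlation; ring.
Qed.

End correlation.

(** * Logarithmic coordinates *)

Section logarithmic_coordinate.
Context {R : realType}.
Local Notation mu := (@lebesgue_measure R).
Context (g0 : R -> R) (hsmooth : smooth_pos g0) (alpha : R) (halpha : 0 < alpha).
Context (hlim0 : forall k : nat,
  (x `^ (k%:R - alpha) * derive1n k g0 x) @[x --> 0^'+] --> (0 : R)).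
Context (hlimoo : forall k : nat,
  (x `^ (k%:R + 1 + alpha) * derive1n k g0 x) @[x --> +oo] --> (0 : R)).

(** The function exp (y / 2) * (x ^ n * g^(n) x) at x = exp y. *)
Definition log_derivative (g : R -> R) (n : nat) (y : R) :=
  expR ((n%:R + 2^-1) * y) * derive1n n g (expR y).
Local Notation H := (log_derivative g0).

(** The isometry from square-integrable functions on the half-line to those on
    the line, applied to the sequence; it turns - x d/dx - 1 / 2 into - d/dy. *)
Definition log_gseq (g : R -> R) (k : nat) (y : R) := expR (y / 2) * gseq g k (expR y).
Local Notation h := (log_gseq g0).

Let dH n (y : R) : is_derive y 1 (H n) ((n%:R + 2^-1) * H n y + H n.+1 y).
Proof.
have e0 : 0 < expR y by exact: expR_gt0.
have d1 : is_derive (expR y) 1 (derive1n n g0) (derive1n n.+1 g0 (expR y)).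
  by apply: DeriveDef; [exact: hsmooth|rewrite derive1nS derive1E].
have d2 := is_derive1_comp d1 (is_derive_expR y).
have d3 : is_derive y 1 (fun y : R => derive1n n g0 (expR y)) (derive1n n.+1 g0 (expR y) * expR y) := d2.
rewrite /log_derivative; apply: is_derive_eq; rewrite /GRing.scale/=.
rewrite -[n.+1%:R]natr1 !mulrDl mul1r !expRD; ring.
Qed.

Let cH n : continuous (H n).
Proof.
move=> y; apply: differentiable_continuous; apply/derivable1_diffP.
by case: (dH n y).
Qed.

(** The two limit hypotheses give the bound outside a segment [- A, A], and
    continuity gives it inside. *)
Let H_le n : exists K, forall y, `|H n y| <= K * expR (- ((2^-1 + alpha) * `|y|)).
Proof.
move: (hlim0 n) => /cvgr0_norm_le l0; have [r /= r0 Hr] := l0 1 ltr01.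
move: (hlimoo n) => /cvgr0_norm_le loo; have [M [_ HM]] := loo 1 ltr01.
pose F y := `|H n y| * expR ((2^-1 + alpha) * `|y|).
have cF : continuous F.
  move=> y; apply: cvgM; first by apply: cvg_norm; exact: cH.
  apply: continuous_comp; last exact: continuous_expR.
  by apply: cvgMr; apply: cvg_norm; exact: cvg_id.
pose A := Num.max 1 (Num.max (- (ln r) + 1) (M + 1)).
have [A1 A2 A3] : [/\ 1 <= A, - (ln r) + 1 <= A & M + 1 <= A].
  by rewrite /A !le_max !lexx !orbT.
have [c cA Fc] : exists2 c, c \in `[- A, A]%R & forall t, t \in `[- A, A]%R -> F t <= F c.
  by apply: EVT_max; [lra|exact: continuous_subspaceT].
exists (Num.max 1 (F c)) => y.
rewrite expRN ler_pdivlMr ?expR_gt0// -/(F y) le_max.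
have [yA|yA] := boolP (y \in `[- A, A]%R); first by rewrite Fc ?orbT.
apply/orP; left.
have [y0|y0] := ltP y (- A).
  have yr : expR y < r by rewrite -[ltRHS]lnK// ltr_expR; lra.
  have := Hr (expR y); rewrite /= sub0r normrN gtr0_norm ?expR_gt0// => /(_ yr isT).
  apply: le_trans; rewrite -expRM.
  rewrite /F /log_derivative !normrM !(gtr0_norm (expR_gt0 _)) mulrAC -expRD.
  rewrite ler_wpM2r// ler_expR ltr0_norm; last by lra.
  by rewrite le_eqVlt; apply/orP; left; apply/eqP; field.
have yA' : A < y by move: yA; rewrite in_itv/= y0/= -ltNge.
have My : M < expR y by rewrite (lt_le_trans _ (expR_ge1Dx _))//; lra.
have := HM _ My; apply: le_trans; rewrite -expRM.
rewrite /F /log_derivative !normrM !(gtr0_norm (expR_gt0 _)) mulrAC -expRD.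
rewrite ler_wpM2r// ler_expR gtr0_norm; last by lra.
by rewrite le_eqVlt; apply/orP; left; apply/eqP; field.
Qed.

(** A space of functions that contains every log_gseq g0 k, and on which
    differentiability and exponential decay are checked on generators; it is
    stable under differentiation. *)
Inductive log_span : (R -> R) -> Prop :=
| log_span_gen n : log_span (H n)
| log_span_lin (a : R) u v : log_span u -> log_span v -> log_span (fun y => a * u y + v y).

Let log_span_derive u : log_span u ->
  exists2 v, log_span v & forall y : R, is_derive y 1 u (v y).
Proof.
elim=> [n|a u1 u2 _ [v1 s1 d1] _ [v2 s2 d2]].
  exists (fun y => (n%:R + 2^-1) * H n y + H n.+1 y); last exact: dH.
  by apply: log_span_lin; exact: log_span_gen.
exists (fun y => a * v1 y + v2 y); first exact: log_span_lin.
by move=> y; have ? := d1 y; have ? := d2 y; apply: is_derive_eq.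
Qed.

Let log_span_le u : log_span u ->
  exists K, forall y, `|u y| <= K * expR (- ((2^-1 + alpha) * `|y|)).
Proof.
elim=> [n|a u1 u2 _ [K1 h1] _ [K2 h2]]; first exact: H_le.
exists (`|a| * K1 + K2) => y.
rewrite (le_trans (ler_normD _ _))// mulrDl lerD// normrM -mulrA.
by rewrite ler_wpM2l.
Qed.

(** The induction step: derive1 in the definition of gseq is meaningful only
    once gseq g0 k is known to be differentiable, which is read off from log_gseq
    g0 k by composing with ln. *)
Let is_derive_log_gseq_of_derivable k (y : R) : derivable (h k) y 1 -> is_derive y 1 (h k) (- h k.+1 y).
Proof.
move=> dk.
have e0 : 0 < expR y := expR_gt0 y.
have dg : derivable (gseq g0 k) (expR y) 1.
  pose P (z : R) := expR (- (z / 2)) * h k z.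
  have dP : is_derive (ln (expR y)) 1 P ('D_1 P y).
    have dl : is_derive y 1 (fun z : R => - (z / 2)) (- 2^-1).
      by apply: is_derive_eq; rewrite /GRing.scale/=; ring.
    have de := is_derive1_comp (is_derive_expR _) dl.
    rewrite expRK; apply: derivableP; apply: derivableM; last exact: dk.
    by case: de.
  have d1 := is_derive1_comp dP (is_derive1_ln e0).
  apply: near_eq_derivable (@ex_derive _ _ _ _ _ _ _ d1).
  near=> x.
  have x0 : 0 < x by near: x; exact: lt_nbhsr.
  by rewrite /= /P /log_gseq lnK// mulrA -expRD addNr expR0 mul1r.
have d1 : is_derive (expR y) 1 (gseq g0 k) (derive1 (gseq g0 k) (expR y)).
  by rewrite derive1E; exact: derivableP.
have d2 : is_derive y 1 (fun y : R => gseq g0 k (expR y)) (derive1 (gseq g0 k) (expR y) * expR y) :=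
  is_derive1_comp d1 (is_derive_expR y).
rewrite {1}/log_gseq; apply: is_derive_eq; rewrite /log_gseq/= /GRing.scale/=; field.
Unshelve. all: by end_near. Qed.

Let log_span_gseq k : log_span (h k).
Proof.
elim: k => [|k IH].
  suff -> : h 0%N = H 0%N by exact: log_span_gen.
  by apply: funext => y; rewrite /log_gseq /log_derivative add0r mulrC [_ * y]mulrC mulrC.
have [v sv dv] := log_span_derive IH.
(* This is - v, written in the form that log_span_lin produces. *)
suff -> : h k.+1 = (fun y => - 2 * v y + v y) by exact: log_span_lin.
apply: funext => y; have dk := dv y.
have [D1 D2] := is_derive_log_gseq_of_derivable (@ex_derive _ _ _ _ _ _ _ dk).
have : v y = - h k.+1 y by rewrite -D2 (@derive_val _ _ _ _ _ _ _ dk).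
lra.
Qed.

Lemma is_derive_log_gseq k (y : R) : is_derive y 1 (h k) (- h k.+1 y).
Proof.
apply: is_derive_log_gseq_of_derivable.
by have [v _ dv] := log_span_derive (log_span_gseq k); case: (dv y).
Qed.

Lemma log_gseq_le : {C : nat -> R |
  forall k y, `|h k y| <= C k * expR (- ((2^-1 + alpha) * `|y|))}.
Proof.
have [C CP] := choice (fun k => log_span_le (log_span_gseq k)).
by exists C.
Qed.

Let mh k : measurable_fun setT (h k).
Proof.
apply: continuous_measurable_fun => y; apply: differentiable_continuous; apply/derivable1_diffP.
by case: (is_derive_log_gseq k y).
Qed.

Let gseq_expR k y : gseq g0 k (expR y) = expR (- (y / 2)) * h k y.
Proof. by rewrite /log_gseq mulrA -expRD addNr expR0 mul1r. Qed.

(** The substitution exp x for the variable, then a translation by y. *)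
Lemma cross_expR k y : cross (gseq g0 k) (expR y) = expR (- (y / 2)) * correlation h k y.
Proof.
pose F w := kernel w * h k (y + w).
have mF : measurable_fun setT F.
  apply: measurable_funM; first exact: measurable_kernel.
  by apply: measurableT_comp => //; exact: measurable_funD.
have mF' : measurable_fun setT (fun x : R => F (x - y)).
  by apply: (measurableT_comp mF); exact: measurable_funB.
have [C hC] := log_gseq_le.
have iF : mu.-integrable setT (EFin \o F).
  apply: (@integrable_bounded_mul _ _ _ (C k)) => //; first exact: integrable_kernel.
    by apply: measurableT_comp => //; exact: measurable_funD.
  move=> w; rewrite (le_trans (hC k _))// ler_piMr//; last first.
    by rewrite -expR0 ler_expR oppr_le0 mulr_ge0// addr_ge0// ltW.
  by have := le_trans (normr_ge0 _) (hC k 0); rewrite pmulr_lge0// expR_gt0.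
have iF' := integrable_shift (- y) iF.
rewrite /cross (Rintegral_expR (k := fun x => expR (- (y / 2)) * F (x - y) * expR (- x))).
- transitivity (\int[mu]_x (expR (- (y / 2)) * F (x - y))).
    by apply: eq_Rintegral => x _; rewrite -mulrA -expRD addNr expR0 mulr1.
  rewrite (RintegralZl _ measurableT iF').
  congr (_ * _).
  exact: (@Rintegral_shift _ (- y) F mF).
- apply: measurable_funM; first exact: measurable_funM.
  by apply: measurableT_comp => //; exact: measurableT_comp.
- move=> x; rewrite gseq_expR /F /kernel /fracexp [y + _]addrC subrK.
  have -> : - ((x - y) / 2) = y / 2 - x / 2 by field.
  rewrite !expRN !expRD !expRN; field.
  by rewrite !gt_eqF// expR_gt0.
Qed.

(** The weights exp (- y / 2) of the two factors absorb the Jacobian exp y. *)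
Lemma gram_correlation k j : gram g0 k j = \int[mu]_y (correlation h k y * correlation h j y).
Proof.
have [C hC] := log_gseq_le.
have b12 : 2^-1 < 2^-1 + alpha by rewrite ltrDl.
have m i : measurable_fun setT (correlation h i).
  apply: continuous_measurable_fun => y; apply: differentiable_continuous; apply/derivable1_diffP.
  by case: (is_derive_correlation b12 is_derive_log_gseq hC i y).
rewrite /gram /scalar_pos.
rewrite (Rintegral_expR (k := fun y => expR (- y) * (correlation h k y * correlation h j y))).
- by apply: eq_Rintegral => y _; rewrite mulrAC -expRD addNr expR0 mul1r.
- by apply: measurable_funM; [do 2 apply: measurableT_comp => //|exact: measurable_funM].
- move=> y; rewrite !cross_expR mulrACA -expRD; congr (expR _ * _); by field.
Qed.

Lemma mellin_critical t : mellin g0 (Complex 2^-1 t) = Complex (cosT (h 0%N) t) (sinT (h 0%N) t).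
Proof.
have E y : g0 (expR y) * (expR ((2^-1 - 1) * y)) * expR y = h 0%N y.
  rewrite /log_gseq -mulrA -expRD mulrC; congr (expR _ * _); by field.
apply/eqP; rewrite eq_complex /mellin; apply/andP; split; apply/eqP; rewrite [LHS]/= [RHS]/=.
- rewrite (Rintegral_expR (k := fun y => expR (- y) * (h 0%N y * cos (t * y)))).
  + by apply: eq_Rintegral => y _; rewrite mulrAC -expRD addNr expR0 mul1r.
  + by apply: measurable_funM; [do 2 apply: measurableT_comp => //|apply: measurable_funM => //; exact: measurable_cosM].
  + by move=> y; rewrite /= expRK subr0 mul0r subr0 -E expRN; field; rewrite gt_eqF// expR_gt0.
- rewrite (Rintegral_expR (k := fun y => expR (- y) * (h 0%N y * sin (t * y)))).
  + by apply: eq_Rintegral => y _; rewrite mulrAC -expRD addNr expR0 mul1r.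
  + by apply: measurable_funM; [do 2 apply: measurableT_comp => //|apply: measurable_funM => //; exact: measurable_sinM].
  + by move=> y; rewrite /= expRK subr0 mul0r addr0 -E expRN; field; rewrite gt_eqF// expR_gt0.
Qed.

Lemma gram_skew k j : gram g0 k j.+1 + gram g0 k.+1 j = 0.
Proof.
have [C hC] := log_gseq_le.
have b12 : 2^-1 < 2^-1 + alpha by rewrite ltrDl.
by rewrite !gram_correlation (correlation_skew b12 is_derive_log_gseq hC).
Qed.

Lemma gram_sym k j : gram g0 k j = gram g0 j k.
Proof. by rewrite !gram_correlation; apply: eq_Rintegral => y _; rewrite mulrC. Qed.

(** By zeta_critical the squared norm of zeta s / s is
    cosT kernel t ^ 2 + sinT kernel t ^ 2, except at the single point t = 0,
    which is discarded as a null set. *)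
Lemma gram_diag (zeta : R[i] -> R[i]) (hzeta : is_riemann_zeta zeta) k :
  (gram g0 k k)%:E = (((2 * pi)^-1)%:E * \int[mu]_t
    (t ^+ (2 * k) * normc (zeta (Complex 2^-1 t) / Complex 2^-1 t
       * mellin g0 (Complex 2^-1 t)) ^+ 2)%:E)%E.
Proof.
have [C hC] := log_gseq_le.
have b12 : 2^-1 < 2^-1 + alpha by rewrite ltrDl.
have b0 : 0 < 2^-1 + alpha by rewrite addr_gt0.
have ih : mu.-integrable setT (EFin \o h 0%N).
  apply: (@le_integrable_EFin _ _ _ (fun y => C 0%N * expR (- ((2^-1 + alpha) * `|y|)))) => //.
  by apply: integrable_scale; exact: integrable_expR_norm.
have mk (F : R -> R) : mu.-integrable setT (EFin \o F) ->
    measurable_fun setT (fun t => cosT F t ^+ 2 + sinT F t ^+ 2).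
  move=> iF; apply: measurable_funD; apply: measurable_funX.
    by apply: continuous_measurable_fun; exact: continuous_cosT.
  by apply: continuous_measurable_fun; exact: continuous_sinT.
pose f t := t ^+ (2 * k) * ((cosT kernel t ^+ 2 + sinT kernel t ^+ 2) *
     (cosT (h 0%N) t ^+ 2 + sinT (h 0%N) t ^+ 2)).
have mf : measurable_fun setT f.
  apply: measurable_funM; first exact: measurable_funX.
  by apply: measurable_funM; apply: mk => //; exact: integrable_kernel.
have fE t : t != 0 -> t ^+ (2 * k) * normc (zeta (Complex 2^-1 t) / Complex 2^-1 t
       * mellin g0 (Complex 2^-1 t)) ^+ 2 = f t.
  move=> t0; rewrite /f; congr (_ * _).
  have [zR zI] := zeta_critical hzeta t0.
  have nsq (z : R[i]) : normc z ^+ 2 = complex.Re z ^+ 2 + complex.Im z ^+ 2.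
    by case: z => a b /=; rewrite sqr_sqrtr// addr_ge0// sqr_ge0.
  rewrite normcM normcM normcV !exprMn exprVn !nsq zR zI mellin_critical/=.
  congr (_ * _).
  have n0 : 2^-1 ^+ 2 + t ^+ 2 != 0 by rewrite gt_eqF// ltr_wpDr ?sqr_ge0// exprn_gt0// invr_gt0.
  by apply: (canLR (mulfK n0)); field.
have m0 : measurable ([set: R] `\ (0 : R)).
  by apply: measurableD.
rewrite -(@integral_setD1 _ _ 0)//; last first.
  apply: (@eq_measurable_fun _ _ _ _ _ (EFin \o f)).
    by move=> t; rewrite inE/= => -[_ /eqP t0]; rewrite fE.
  by apply: measurable_funTS; exact/measurable_EFinP.
transitivity (((2 * pi)^-1)%:E * \int[mu]_(t in [set: R] `\ 0%R) (f t)%:E)%E; last first.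
  congr (_ * _)%E; apply: eq_integral => t; rewrite inE/= => -[_ /eqP t0].
  by rewrite fE.
rewrite integral_setD1//; last by apply: measurable_funTS; exact/measurable_EFinP.
rewrite (correlation_plancherel b12 is_derive_log_gseq hC) -gram_correlation -EFinM.
by rewrite mulrA mulVf ?mul1r// mulf_neq0// gt_eqF// pi_gt0.
Qed.

End logarithmic_coordinate.

(** * Symmetric matrices with opposite neighbours on antidiagonals *)

Section skew_matrix.
Context {R : realType} (G : nat -> nat -> R).
Context (Gsym : forall k j, G k j = G j k).
Context (Gskew : forall k j, G k j.+1 + G k.+1 j = 0).

(** The sign alternates along each antidiagonal. *)
Let slide m k j : G k (m + j) = (-1) ^+ m * G (m + k) j.
Proof.
elim: m k => [|m IH] k; first by rewrite expr0 mul1r.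
have := Gskew k (m + j); rewrite -addSn => /eqP; rewrite addr_eq0 => /eqP ->.
by rewrite IH addnS -addSn exprS mulN1r mulNr.
Qed.

(** G k k.+1 is the opposite of G k.+1 k, which equals it by symmetry. *)
Lemma skew_superdiagonal k : G k k.+1 = 0.
Proof. by have := Gskew k k; rewrite [G k.+1 k]Gsym => H; lra. Qed.

Lemma skew_odd k j : odd (k + j) -> G k j = 0.
Proof.
wlog kj : k j / (k <= j)%N => [W|kjo].
  by case/orP: (leq_total k j) => kj; [exact: W|rewrite Gsym addnC; exact: W].
have -> : j = ((j - k)./2 + ((j - k)./2 + k).+1)%N by lia.
by rewrite slide skew_superdiagonal mulr0.
Qed.

Lemma skew_even k m : G k (m + (m + k)) = (-1) ^+ m * G (m + k)%N (m + k)%N.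
Proof. exact: slide. Qed.

Lemma skew_even_div k j : ~~ odd (k + j) ->
  G k j = (-1) ^ ((k%:Z - j%:Z) %/ 2)%Z * G (k + j)./2 (k + j)./2.
Proof.
have [kj|/ltnW kj] := leqP k j => kjo.
- have [m jE] : exists m, j = (m + (m + k))%N by exists (j - k)./2; lia.
  have -> : ((k%:Z - j%:Z) %/ 2)%Z = - m%:Z by lia.
  have -> : ((k + j)./2 = m + k)%N by lia.
  by rewrite jE skew_even -exprnN -exprVn invrN1.
- have [m kE] : exists m, k = (m + (m + j))%N by exists (k - j)./2; lia.
  have -> : ((k%:Z - j%:Z) %/ 2)%Z = m%:Z by lia.
  have -> : ((k + j)./2 = m + j)%N by lia.
  by rewrite kE Gsym skew_even.
Qed.

(** Covers both parities: i = 1 gives the odd block and i = 0 the even one. *)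
Lemma skew_shift_even i a b : (i <= a + a)%N -> (i <= b + b)%N ->
  G (a + a - i)%N (b + b - i)%N = (-1) ^+ (a + b) * G (a + b - i)%N (a + b - i)%N.
Proof.
wlog ab : a b / (a <= b)%N => [W|ia ib].
  by case/orP: (leq_total a b) => ab ia ib; [exact: W|rewrite Gsym (addnC a b); exact: W].
have -> : (b + b - i = (b - a) + ((b - a) + (a + a - i)))%N by lia.
rewrite skew_even; have -> : ((b - a) + (a + a - i) = a + b - i)%N by lia.
by congr (_ * _); rewrite -signr_odd -[RHS]signr_odd oddB// oddD addbC.
Qed.

End skew_matrix.

(** * The Gram matrix *)

Theorem mainTheorem6 (R : realType) (zeta : R[i] -> R[i])
    (hzeta : is_riemann_zeta zeta)
    (g0 : R -> R) (hsmooth : smooth_pos g0)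
    (alpha : R) (halpha : 0 < alpha)
    (hlim0 : forall k : nat,
       (x `^ (k%:R - alpha) * derive1n k g0 x) @[x --> 0^'+] --> (0 : R))
    (hlimoo : forall k : nat,
       (x `^ (k%:R + 1 + alpha) * derive1n k g0 x) @[x --> +oo] --> (0 : R)) :
  let G := gram g0 in
  ((forall k j : nat, (1 <= j)%N -> G k j + G k.+1 j.-1 = 0) /\
   (forall k : nat, G k k.+1 = 0)) /\
  (forall k : nat,
     (G k k)%:E =
     (((2 * pi)^-1)%:E *
       \int[lebesgue_measure]_t
         (t ^+ (2 * k) *
          normc (zeta (Complex 2^-1 t) / Complex 2^-1 t
                 * mellin g0 (Complex 2^-1 t)) ^+ 2)%:E)%E) /\
  ((forall k j : nat, (1 <= k)%N -> (1 <= j)%N -> odd (k + j) -> G k j = 0) /\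
   (forall k j : nat, (1 <= k)%N -> (1 <= j)%N -> ~~ odd (k + j) ->
      G k j = (-1) ^ ((k%:Z - j%:Z) %/ 2)%Z * G (k + j)./2 (k + j)./2) /\
   (forall u v : nat + nat, pos_index u -> pos_index v ->
      G (renum u) (renum v) = block_diag (odd_block G) (even_block G) u v) /\
   hankel (odd_block G) /\
   hankel (even_block G) /\
   (forall a b : nat, (1 <= a)%N -> (1 <= b)%N ->
      odd_block G a b = (-1) ^+ (a + b) * G (a + b - 1)%N (a + b - 1)%N) /\
   (forall a b : nat, (1 <= a)%N -> (1 <= b)%N ->
      even_block G a b = (-1) ^+ (a + b) * G (a + b)%N (a + b)%N)).
Proof.
move=> G.
have Gsym k j : G k j = G j k by exact: (gram_sym hsmooth halpha hlim0 hlimoo).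
have Gskew k j : G k j.+1 + G k.+1 j = 0 by exact: (gram_skew hsmooth halpha hlim0 hlimoo).
have oddE a b : (1 <= a)%N -> (1 <= b)%N ->
    odd_block G a b = (-1) ^+ (a + b) * G (a + b - 1)%N (a + b - 1)%N.
  move=> a1 b1; rewrite /odd_block !mul2n -!addnn.
  by apply: skew_shift_even => //; lia.
have evenE a b : (1 <= a)%N -> (1 <= b)%N ->
    even_block G a b = (-1) ^+ (a + b) * G (a + b)%N (a + b)%N.
  move=> _ _; rewrite /even_block !mul2n -!addnn.
  by have := skew_shift_even Gsym Gskew (leq0n (a + a)) (leq0n (b + b)); rewrite !subn0.
split; first split.
- by move=> k [//|j] _; exact: Gskew.
- exact: skew_superdiagonal.
split; first by move=> k; exact: (gram_diag hsmooth halpha hlim0 hlimoo hzeta).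
clearbody G.
split; first by move=> k j _ _; exact: skew_odd.
split; first by move=> k j _ _; exact: skew_even_div.
split.
  move=> [a|a] [b|b] //= a0 b0; apply: skew_odd => //; lia.
split; first by move=> a b a' b' a0 b0 a0' b0' E; rewrite !oddE// E.
split; first by move=> a b a' b' a0 b0 a0' b0' E; rewrite !evenE// E.
by split.
Qed.
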